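(* Let $f,g_1,\dots,g_m\in\mathbb{R}[\mathbf{x}]$, $\mathbf{X}=\{\mathbf{x}\in\mathbb{R}^n:g_1(\mathbf{x})\ge0,\dots,g_m(\mathbf{x})\ge0\}$, and for $r\ge r_{\min}$ and $s\ge1$ let $f^{r,s}_{\mathrm{ts}}$ be the optimal value of $$\mathbf{P}^{r,s}_{\mathrm{ts}}:\ \inf_{\mathbf{y}}\{L_{\mathbf{y}}(f):\ \mathbf{B}_{G^{(s)}_{r,j}}\circ\mathbf{M}_{r-d_j}(g_j\mathbf{y})\in\Pi_{G^{(s)}_{r,j}}(\mathbb{S}^+_{t_j})\ (j=0,1,\dots,m),\ y_{\mathbf{0}}=1\}$$ and $f^r_{\mathrm{mom}}$ the optimal value of $\inf_{\mathbf{y}}\{L_{\mathbf{y}}(f):\mathbf{M}_{r-d_j}(g_j\mathbf{y})\succeq0\ (j=0,\dots,m),\ y_{\mathbf{0}}=1\}$. Then: (i) if $\mathbf{X}$ has nonempty interior, then for all $r\ge r_{\min}$, $s\ge1$ there is no duality gap between $\mathbf{P}^{r,s}_{\mathrm{ts}}$ and its dual $$\sup_{\mathbf{G}_j,b}\Big\{b:\ \sum_{j=0}^m\langle\mathbf{C}^j_\alpha,\mathbf{G}_j\rangle=f_\alpha-b\,1_{\alpha=\mathbf{0}}\ \ \forall\alpha\in\bigcup_{j=0}^m\big(\operatorname{supp}(g_j)+\operatorname{supp}(G^{(s)}_{r,j})\big),\ \mathbf{G}_j\in\mathbb{S}^+_{t_j}\cap\mathbb{S}(G^{(s)}_{r,j})\Big\};$$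 (ii) for fixed $r\ge r_{\min}$, $(f^{r,s}_{\mathrm{ts}})_{s\ge1}$ is monotonically nondecreasing and $f^{r,s}_{\mathrm{ts}}\le f^r_{\mathrm{mom}}$ for all $s\ge1$; (iii) if the maximal chordal extension is used in the chordal extension operation, then for each $r\ge r_{\min}$ the sequence $(f^{r,s}_{\mathrm{ts}})_{s\ge1}$ reaches $f^r_{\mathrm{mom}}$ after finitely many steps; (iv) for fixed $s\ge1$, $(f^{r,s}_{\mathrm{ts}})_{r\ge r_{\min}}$ is monotonically nondecreasing.
   Context: $g_0=1$, $d_j=\lceil\deg(g_j)/2\rceil$ ($d_0=0$), $r_{\min}=\max\{\lceil\deg(f)/2\rceil,d_1,\dots,d_m\}$, $\mathbb{N}^n_k=\{\alpha\in\mathbb{N}^n:\sum_i\alpha_i\le k\}$, $\mathscr{B}_{r,j}=\mathbb{N}^n_{r-d_j}$, $t_j=|\mathscr{B}_{r,j}|$, $\mathscr{A}=\operatorname{supp}(f)\cup\bigcup_{j=1}^m\operatorname{supp}(g_j)$. $L_{\mathbf{y}}(\sum_\alpha h_\alpha\mathbf{x}^\alpha)=\sum_\alpha h_\alpha y_\alpha$; $\mathbf{M}_{r-d_j}(g_j\mathbf{y})$ is the matrix indexed by $\mathbb{N}^n_{r-d_j}$ with $(\beta,\gamma)$-entry $L_{\mathbf{y}}(g_j\mathbf{x}^{\beta+\gamma})$. $\mathbf{C}^j_\alpha$ is the matrix indexed by $\mathbb{N}^n_{r-d_j}$ with $(\beta,\gamma)$-entry $\sum_{\beta+\gamma+\delta=\alpha}g_{j,\delta}$,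 where $g_j=\sum_\delta g_{j,\delta}\mathbf{x}^\delta$; $f=\sum_\alpha f_\alpha\mathbf{x}^\alpha$. Graphs: a chordal graph has a chord in every cycle of length $\ge4$; a chordal extension $G'$ of $G$ is a chordal graph on the same nodes containing $G$; chordal extensions are fixed so that $G\subseteq H$ (nodes and edges) implies $G'\subseteq H'$; the maximal chordal extension turns each connected component into a clique. For a graph $G$ with nodes $V\subseteq\mathbb{N}^n$, $\operatorname{supp}(G)=\{\beta+\gamma:\beta=\gamma\in V\text{ or }\{\beta,\gamma\}\in E(G)\}$; for $S,T\subseteq\mathbb{N}^n$, $S+T=\{a+b:a\in S,b\in T\}$. Construction: $G^{(0)}_{r,0}$ has nodes $\mathscr{B}_{r,0}$ and edges $\{\beta,\gamma\}$, $\beta\ne\gamma$, with $\beta+\gamma\in\mathscr{A}\cup2\mathscr{B}_{r,0}$; for $j\in[m]$, $G^{(0)}_{r,j}$ is the edgeless graph on $\mathscr{B}_{r,j}$. For $s\ge1$ and $j=0,\dots,m$, $F^{(s)}_{r,j}$ has nodes $\mathscr{B}_{r,j}$ and edges $\{\beta,\gamma\}$, $\beta\ne\gamma$, such that $(\operatorname{supp}(g_j)+\beta+\gamma)\cap\bigcup_{i=0}^m(\operatorname{supp}(g_i)+\operatorname{supp}(G^{(s-1)}_{r,i}))\ne\emptyset$, and $G^{(s)}_{r,j}=(F^{(s)}_{r,j})'$. For a graph $G$ on $V$: $\mathbb{S}(G)$ is the set of symmetric matrices indexed by $V$ vanishing at off-diagonal non-edges; $\Pi_G$ zeroes those entries;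 $\Pi_G(\mathbb{S}^+_{|V|})=\{\Pi_G(\mathbf{Q}):\mathbf{Q}\succeq0\}$; $\mathbf{B}_G$ is the adjacency matrix of $G$ with unit diagonal; $\circ$ is the entrywise product; $\langle\mathbf{A},\mathbf{B}\rangle=\operatorname{tr}(\mathbf{A}\mathbf{B})$. *)

(* Defs.v *)
From mathcomp Require Import all_boot all_order all_algebra.
From mathcomp Require Import mpoly.
From mathcomp Require Import classical_sets boolp cardinality reals constructive_ereal ereal.
Unset Printing Implicit Defensive.
Import Order.TTheory GRing.Theory Num.Theory.
Local Open Scope classical_set_scope.
Local Open Scope ring_scope.

Record graph (n : nat) := Graph
  { gV : set (mpoly.multinom n); gE : mpoly.multinom n -> mpoly.multinom n -> Prop }.
Arguments Graph {n}. Arguments gV {n}. Arguments gE {n}.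

Section Graphs.
Variable n : nat.
Local Notation mon := (mpoly.multinom n).
Local Notation graph := (graph n).

Definition wf_graph (G : graph) : Prop :=
  finite_set (gV G) /\
  (forall a b, gE G a b -> a <> b /\ gV G a /\ gV G b) /\
  (forall a b, gE G a b -> gE G b a).

Definition subgraph (G H : graph) : Prop :=
  (forall a, gV G a -> gV H a) /\ (forall a b, gE G a b -> gE H a b).

Definition chordal (G : graph) : Prop :=
  forall s : seq mon, (4 <= size s)%N -> uniq s ->
    (forall v, v \in s -> gV G v) ->
    (forall i, (i < size s)%N ->
       gE G (nth (@mpoly.mnm0 n) s i) (nth (@mpoly.mnm0 n) s (i.+1 %% size s))) ->
    exists i j, (i.+1 < j)%N /\ (j < size s)%N /\ ~ (i = 0%N /\ j = (size s).-1) /\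
      gE G (nth (@mpoly.mnm0 n) s i) (nth (@mpoly.mnm0 n) s j).

Definition valid_chordal_ext (ext : graph -> graph) : Prop :=
  (forall G, wf_graph G ->
     [/\ wf_graph (ext G), gV (ext G) = gV G,
         (forall a b, gE G a b -> gE (ext G) a b) & chordal (ext G)]) /\
  (forall G H, wf_graph G -> wf_graph H -> subgraph G H ->
     subgraph (ext G) (ext H)).

Definition gconnected (G : graph) (a b : mon) : Prop :=
  exists s : seq mon,
    (forall i, (i < size s)%N -> gE G (nth a (a :: s) i) (nth a s i)) /\
    last a s = b.

Definition max_chordal_ext (G : graph) : graph :=
  Graph (gV G) (fun a b => a <> b /\ gV G a /\ gV G b /\ gconnected G a b).

End Graphs.

Section Moments.
Variables (R : realType) (n : nat).
Local Notation mon := (mpoly.multinom n).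
Local Notation poly := (mpoly.mpoly n R).
Local Notation madd := (@mpoly.mnm_add n).

Definition pdeg (p : poly) : nat := \max_(a <- mpoly.msupp p) mpoly.mdeg a.
Definition hdeg (p : poly) : nat := uphalf (pdeg p).

Definition psupp (p : poly) : set mon := [set a | a \in mpoly.msupp p].

Definition msumset (S T : set mon) : set mon :=
  [set c | exists a b, S a /\ T b /\ c = madd a b].

Definition gsupp (G : graph n) : set mon :=
  [set c | exists a b, ((a = b /\ gV G a) \/ gE G a b) /\ c = madd a b].

Definition Nk (k : nat) : set mon := [set a | (mpoly.mdeg a <= k)%N].
(* N^n_k as a finite index type *)
Definition Idx (k : nat) : finType := mpoly.bmultinom n k.+1.

Definition Ly (y : mon -> R) (p : poly) : R :=
  \sum_(a <- mpoly.msupp p) mpoly.mcoeff a p * y a.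

Definition psd (T : finType) (A : T -> T -> R) : Prop :=
  (forall i j, A i j = A j i) /\
  (forall v : T -> R, 0 <= \sum_i \sum_j v i * A i j * v j).

Definition inpat (G : graph n) (b c : mon) : Prop := b = c \/ gE G b c.

Definition Bmask (G : graph n) (k : nat) : Idx k -> Idx k -> R :=
  fun b c => if pselect (inpat G (val b) (val c)) then 1 else 0.

Definition hadamard (T : finType) (A B : T -> T -> R) : T -> T -> R :=
  fun b c => A b c * B b c.

Definition PiG (G : graph n) (k : nat) (Q : Idx k -> Idx k -> R) :
    Idx k -> Idx k -> R :=
  fun b c => if pselect (inpat G (val b) (val c)) then Q b c else 0.

Definition in_PiG_psd (G : graph n) (k : nat) (A : Idx k -> Idx k -> R) : Prop :=
  exists Q : Idx k -> Idx k -> R, psd _ Q /\ PiG G k Q = A.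

Definition in_SG (G : graph n) (k : nat) (A : Idx k -> Idx k -> R) : Prop :=
  (forall b c, A b c = A c b) /\
  (forall b c : Idx k, b <> c -> ~ gE G (val b) (val c) -> A b c = 0).

Definition frob (T : finType) (A B : T -> T -> R) : R :=
  \sum_b \sum_c A b c * B c b.

Variables (m : nat) (f : poly) (g : 'I_m -> poly).

Definition gj (j : 'I_m.+1) : poly :=
  if unlift ord0 j is Some i then g i else 1.

Definition dj (j : 'I_m.+1) : nat := hdeg (gj j).

Definition rmin : nat := maxn (hdeg f) (\max_(j < m.+1) dj j).

Definition Bset (r : nat) (j : 'I_m.+1) : set mon := Nk (r - dj j)%N.

Definition Aset : set mon := [set a | psupp f a \/ exists i, psupp (g i) a].

Definition G0 (r : nat) (j : 'I_m.+1) : graph n :=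
  if j == ord0 then
    Graph (Bset r j) (fun a b => a <> b /\ Bset r j a /\ Bset r j b /\
       (Aset (madd a b) \/ exists d, Bset r j d /\ madd a b = madd d d))
  else Graph (Bset r j) (fun _ _ => False).

Definition Fgraph (r : nat) (j : 'I_m.+1) (prev : 'I_m.+1 -> graph n) : graph n :=
  Graph (Bset r j) (fun a b => a <> b /\ Bset r j a /\ Bset r j b /\
    exists c, msumset (psupp (gj j)) [set madd a b] c /\
              exists i, msumset (psupp (gj i)) (gsupp (prev i)) c).

Fixpoint Gts (ext : graph n -> graph n) (r s : nat) : 'I_m.+1 -> graph n :=
  if s is s'.+1 then fun j => ext (Fgraph r j (Gts ext r s')) else G0 r.

Definition Mmat (r : nat) (j : 'I_m.+1) (y : mon -> R) :
    Idx (r - dj j)%N -> Idx (r - dj j)%N -> R :=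
  fun b c => Ly y (gj j * mpoly.mpolyX R (madd (val b) (val c))).

Definition Cmat (r : nat) (j : 'I_m.+1) (alpha : mon) :
    Idx (r - dj j)%N -> Idx (r - dj j)%N -> R :=
  fun b c => \sum_(d <- mpoly.msupp (gj j) | madd (madd (val b) (val c)) d == alpha)
               mpoly.mcoeff d (gj j).

Definition f_ts (ext : graph n -> graph n) (r s : nat) : \bar R :=
  ereal_inf [set (Ly y f)%:E | y in
    [set y : mon -> R | y (@mpoly.mnm0 n) = 1 /\
       forall j, in_PiG_psd (Gts ext r s j) (r - dj j)%N
                   (hadamard _ (Bmask (Gts ext r s j) (r - dj j)%N) (Mmat r j y))]].

Definition f_ts_dual (ext : graph n -> graph n) (r s : nat) : \bar R :=
  ereal_sup [set b%:E | b in
    [set b : R | exists Gm : forall j : 'I_m.+1, Idx (r - dj j)%N -> Idx (r - dj j)%N -> R,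
       (forall j, psd _ (Gm j) /\ in_SG (Gts ext r s j) _ (Gm j)) /\
       (forall alpha, (exists j, msumset (psupp (gj j)) (gsupp (Gts ext r s j)) alpha) ->
          \sum_(j < m.+1) frob _ (Cmat r j alpha) (Gm j)
            = mpoly.mcoeff alpha f - (if alpha == @mpoly.mnm0 n then b else 0))]].

Definition f_mom (r : nat) : \bar R :=
  ereal_inf [set (Ly y f)%:E | y in
    [set y : mon -> R | y (@mpoly.mnm0 n) = 1 /\ forall j, psd _ (Mmat r j y)]].

Definition Xset : set ('I_n -> R) :=
  [set x | forall i, 0 <= mpoly.meval x (g i)].

Definition nonempty_interior : Prop :=
  exists x0 : 'I_n -> R, exists e : R, 0 < e /\
    forall x : 'I_n -> R, (forall i, `|x i - x0 i| < e) -> Xset x.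

End Moments.

Arguments valid_chordal_ext {n}.
Arguments max_chordal_ext {n}.
Arguments rmin {R n m}.
Arguments nonempty_interior {R n m}.
Arguments f_ts {R n m}.
Arguments f_ts_dual {R n m}.
Arguments f_mom {R n m}.

(* Main.v *)
(** Strong duality comes from the M. Riesz extension theorem.  Collect the blocks
    of the moment relaxation into one square matrix, and let [F] be the space of
    matrices that agree on the sparsity pattern with the moment matrices of some
    [y].  On [F] the linear functional [L_y(f) - p y_0], with [p] the primal
    value, is nonnegative at positive semidefinite matrices.  Moments of finitely
    many points of an open ball of X give a positive definite element of [F], so
    the functional extends to a nonnegative functional on all matrices, which is
    the pairing with a dual optimal Gram matrix.  No closedness or compactness
    argument is needed.

    For the maximal chordal extension, once the increasing graphs are stable, the
    monomials outside the support of the graphs can be given moment zero, and the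
    moment matrices become block diagonal. *)
Require Import Defs.
From mathcomp Require Import all_boot all_order all_algebra.
From mathcomp Require Import mpoly.
From mathcomp Require Import classical_sets boolp cardinality reals constructive_ereal ereal.
From mathcomp Require Import ring lra zify.
Import Order.TTheory GRing.Theory Num.Theory.
Set Implicit Arguments.
Unset Strict Implicit.
Local Open Scope ring_scope.

(** * Quadratic forms *)

Section QuadraticForms.
Variable R : realType.
Implicit Types S T : finType.

Definition qform T (A : T -> T -> R) (v : T -> R) : R :=
  \sum_i \sum_j v i * A i j * v j.

Lemma qformD T (A B : T -> T -> R) v :
  qform (fun i j => A i j + B i j) v = qform A v + qform B v.
Proof.
rewrite /qform -big_split; apply: eq_bigr => i _; rewrite -big_split.
by apply: eq_bigr => j _ /=; rewrite mulrDr mulrDl.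
Qed.

Lemma qformZ T (A : T -> T -> R) a v :
  qform (fun i j => a * A i j) v = a * qform A v.
Proof.
rewrite /qform big_distrr; apply: eq_bigr => i _; rewrite big_distrr.
by apply: eq_bigr => j _ /=; rewrite mulrCA !mulrA.
Qed.

Lemma qform_tr T (A : T -> T -> R) v :
  qform (fun i j => A j i) v = qform A v.
Proof.
rewrite /qform exchange_big /=; apply: eq_bigr => i _; apply: eq_bigr => j _.
by ring.
Qed.

Lemma qform_rank1 T (w v : T -> R) :
  qform (fun i j => w i * w j) v = (\sum_i w i * v i) ^+ 2.
Proof.
rewrite /qform expr2 big_distrl /=; apply: eq_bigr => i _.
rewrite big_distrr /=; apply: eq_bigr => j _; ring.
Qed.

Lemma qform_delta T (A : T -> T -> R) k : qform A (fun i => (i == k)%:R) = A k k.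
Proof.
rewrite /qform (bigD1 k) //= [X in _ + X]big1 ?addr0; last first.
  by move=> i /negbTE ->; rewrite big1 // => j _; rewrite !mul0r.
rewrite (bigD1 k) //= big1 ?addr0 ?eqxx ?mul1r ?mulr1 //.
by move=> i /negbTE ->; rewrite mulr0.
Qed.

Lemma qformDl T (A : T -> T -> R) (u v : T -> R) t : (forall i j, A i j = A j i) ->
  qform A (fun i => u i + t * v i) =
  qform A u + t * (2 * \sum_i \sum_j u i * A i j * v j) + t ^+ 2 * qform A v.
Proof.
move=> Asym; set c := \sum_i _.
have cE : c = \sum_i \sum_j v i * A i j * u j.
  rewrite /c exchange_big; apply: eq_bigr => i _; apply: eq_bigr => j _.
  by rewrite Asym; ring.
rewrite mulr2n mulrDl mul1r {2}cE mulrDr !big_distrr /= -!big_split /=.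
apply: eq_bigr => i _; rewrite !big_distrr /= -!big_split /=.
by apply: eq_bigr => j _; ring.
Qed.

(** The pulled back form at [v] is the form of [A] at the vector of sums of [v] over the fibres of
    [h]. For injective [h] this is the passage to a principal submatrix. *)
Lemma psd_comp {S T} (h : S -> T) (A : T -> T -> R) :
  psd R T A -> psd R S (fun i j => A (h i) (h j)).
Proof.
move=> [Asym Age0]; split=> [i j|v]; first exact: Asym.
pose w a := \sum_(i | h i == a) v i.
rewrite (le_trans (Age0 w)) // le_eqVlt; apply/orP; left; apply/eqP.
rewrite [RHS](partition_big h predT) //=; apply: eq_bigr => a _.
rewrite /w; under eq_bigr do rewrite big_distrl big_distrl /=.
rewrite exchange_big /=; apply: eq_bigr => i /eqP <-.
rewrite [RHS](partition_big h predT) //=; apply: eq_bigr => b _.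
by rewrite big_distrr /=; apply: eq_bigr => j /eqP <-.
Qed.

(** Cutting [v] along the classes of [c] turns the masked form into a sum, over the classes, of
    values of the form of [A]. *)
Lemma psd_mask {T} {K : finType} (c : T -> K) (A : T -> T -> R) :
  psd R T A -> psd R T (fun i j => if c i == c j then A i j else 0).
Proof.
move=> [Asym Age0]; split=> [i j|v]; first by rewrite eq_sym Asym.
pose w k i := if c i == k then v i else 0.
suff -> : \sum_i \sum_j v i * (if c i == c j then A i j else 0) * v j
        = \sum_k \sum_i \sum_j w k i * A i j * w k j by apply: sumr_ge0.
rewrite [RHS]exchange_big; apply: eq_bigr => i _ /=.
rewrite [RHS]exchange_big; apply: eq_bigr => j _ /=.
rewrite (bigD1 (c i)) //= big1 ?addr0; last first.
  by move=> k /negbTE ki; rewrite /w eq_sym ki !mul0r.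
by rewrite /w eqxx eq_sym; case: eqP => _; rewrite ?mulr0 ?mul0r.
Qed.

Lemma psd_diag_ge0 {T} {A : T -> T -> R} k : psd R T A -> 0 <= A k k.
Proof. by move=> [_ /(_ (fun i => (i == k)%:R))]; rewrite -/(qform A _) qform_delta. Qed.

Lemma psd_cauchy_schwarz {T} {A : T -> T -> R} (u v : T -> R) : psd R T A ->
  (\sum_i \sum_j u i * A i j * v j) ^+ 2 <= qform A u * qform A v.
Proof.
move=> [Asym Age0]; set c := \sum_i _.
have q_ge0 t : 0 <= qform A u + t * (2 * c) + t ^+ 2 * qform A v.
  by rewrite -qformDl //; apply: Age0.
have qv : 0 <= qform A v := Age0 v; have qu : 0 <= qform A u := Age0 u.
have [qv0|qv0] := eqVneq (qform A v) 0.
  have [->|c0] := eqVneq c 0; first by rewrite qv0 mulr0 expr0n.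
  (* Without its quadratic term the function of [t] is affine with nonzero slope; here it would take
     the value -1. *)
  have := q_ge0 (- (qform A u + 1) / (2 * c)).
  have -> : - (qform A u + 1) / (2 * c) * (2 * c) = - (qform A u + 1) by field.
  by rewrite qv0 mulr0 addr0 => ?; exfalso; lra.
have qv1 : 0 < qform A v by rewrite lt0r qv0.
(* This [t] minimises the quadratic polynomial. *)
have := q_ge0 (- c / qform A v).
suff -> : qform A u + - c / qform A v * (2 * c) +
    (- c / qform A v) ^+ 2 * qform A v =
    (qform A u * qform A v - c ^+ 2) / qform A v.
  by rewrite pmulr_lge0 ?invr_gt0 // subr_ge0.
by field.
Qed.

Lemma psd_entry_sq {T} {A : T -> T -> R} i j : psd R T A -> A i j ^+ 2 <= A i i * A j j.
Proof.
move=> Apsd.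
have := psd_cauchy_schwarz (fun k => (k == i)%:R) (fun k => (k == j)%:R) Apsd.
rewrite !qform_delta.
rewrite (bigD1 i) //= [X in _ + X]big1 ?addr0; last first.
  by move=> k /negbTE ->; rewrite big1 // => l _; rewrite !mul0r.
rewrite (bigD1 j) //= big1 ?addr0 ?eqxx ?mul1r ?mulr1 //.
by move=> k /negbTE ->; rewrite mulr0.
Qed.

(* Eliminating a nonzero pivot splits off a rank-one matrix and leaves a
   positive semidefinite Schur complement with fewer nonzero diagonal entries. *)
Lemma psd_frob_ge0 {T} (A B : T -> T -> R) :
  psd R T A -> psd R T B -> 0 <= \sum_i \sum_j A i j * B i j.
Proof.
move=> Apsd Bpsd.
have [N leN] := ubnP #|[pred i | A i i != 0]|; elim: N => // N IH in A Apsd leN *.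
have [k Ak|A0] := pickP [pred i | A i i != 0]; last first.
  rewrite big1 // => i _; rewrite big1 // => j _.
  suff /eqP -> : A i j == 0 by rewrite mul0r.
  have /negbFE/eqP Ai0 := A0 i.
  have := psd_entry_sq i j Apsd.
  by rewrite Ai0 mul0r -sqrf_eq0 eq_le sqr_ge0 andbT.
rewrite /= in Ak; have [Asym Age0] := Apsd.
pose C i j := A i j - A i k * A k j / A k k.
have Cpsd : psd R T C.
  split=> [i j|v].
    by rewrite /C (Asym i j) (Asym i k) (Asym k j) [A k i * _]mulrC.
  (* This [t] minimises the form of [A] along [v + t e_k], and the minimum is the form of [C] at
     [v]. *)
  pose t := - (\sum_j A k j * v j) / A k k.
  have := Age0 (fun i => v i + t * (i == k)%:R).
  rewrite -/(qform A _) qformDl // qform_delta.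
  have -> : \sum_i \sum_j v i * A i j * (j == k)%:R = \sum_j A k j * v j.
    apply: eq_bigr => i _; rewrite (bigD1 k) //= big1 ?addr0 ?eqxx ?mulr1.
      by rewrite mulrC Asym.
    by move=> l /negbTE ->; rewrite mulr0.
  rewrite -/(qform C v).
  have -> : qform C v = qform A v - (\sum_j A k j * v j) ^+ 2 / A k k.
    rewrite -qform_rank1 [_ / _]mulrC -mulNr -qformZ -qformD.
    rewrite /qform; apply: eq_bigr => i _; apply: eq_bigr => j _.
    by rewrite /C (Asym i k); congr (_ * _ * _); ring.
  suff -> : qform A v + t * (2 * \sum_j A k j * v j) + t ^+ 2 * A k k =
            qform A v - (\sum_j A k j * v j) ^+ 2 / A k k by [].
  by rewrite /t; field.
(* A zero diagonal entry of [A] forces a zero in column [k], so it stays zero in [C]; the pivot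
   entry becomes zero too. *)
have ltC : (#|[pred i | C i i != 0%R]| < N)%N.
  rewrite -ltnS (leq_trans _ leN) // ltnS; apply: proper_card; apply/fintype.properP; split.
    apply/fintype.subsetP => i; rewrite !inE; apply: contraNneq => Ai0.
    have := psd_entry_sq i k Apsd; rewrite Ai0 mul0r => Aik.
    have /eqP Aik0 : A i k == 0 by rewrite -sqrf_eq0 eq_le Aik sqr_ge0.
    by rewrite /C Ai0 Aik0 !mul0r subr0.
  by exists k; rewrite !inE // negbK /C mulfK // subrr.
have -> : \sum_i \sum_j A i j * B i j = \sum_i \sum_j C i j * B i j
            + (A k k)^-1 * qform B (fun i => A i k).
  rewrite /qform big_distrr -big_split; apply: eq_bigr => i _.
  rewrite big_distrr -big_split; apply: eq_bigr => j _ /=.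
  by rewrite /C (Asym j k); field.
by rewrite addr_ge0 ?IH // mulr_ge0 ?invr_ge0 ?(psd_diag_ge0 _ Apsd) //; apply: Bpsd.2.
Qed.

(** A definite matrix is invertible. If [u] is row [k] of its inverse, then [v k] is the pairing of
    [u] and [v] through [A], and Cauchy-Schwarz bounds its square with [t = qform A u]. *)
Lemma posdef_coord_bound {T} (A : T -> T -> R) :
  psd R T A -> (forall v, qform A v = 0 -> forall i, v i = 0) ->
  forall k, exists2 t, 0 <= t & forall v, v k ^+ 2 <= t * qform A v.
Proof.
move=> Apsd Adef k; have [Asym Age0] := Apsd.
pose N := #|T|; pose M : 'M[R]_N := \matrix_(i, j) A (enum_val i) (enum_val j).
have sumT (F : T -> R) : \sum_i F i = \sum_(i < N) F (enum_val i).
  by rewrite (reindex (@enum_val T T)) //=; apply: onW_bij; exact: enum_val_bij.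
have Mfree : row_free M.
  rewrite -kermx_eq0; apply/rowV0P => w /sub_kermxP wM.
  apply/rowP => i; rewrite mxE.
  pose v a := w 0 (enum_rank a).
  suff : v (enum_val i) = 0 by rewrite /v enum_valK.
  apply: Adef; rewrite /qform exchange_big /= big1 // => b _.
  rewrite -big_distrl /= [X in X * _](_ : _ = 0) ?mul0r //.
  have := congr1 (fun X : 'M_(1, N) => X 0 (enum_rank b)) wM; rewrite !mxE => wMb.
  by rewrite sumT -[RHS]wMb; apply: eq_bigr => j _; rewrite mxE /v enum_valK enum_rankK.
have : M \in unitmx by rewrite -row_free_unit.
move=> Munit.
pose u a := invmx M (enum_rank k) (enum_rank a).
exists (qform A u) => [|v]; first exact: Age0.
have uA b : \sum_i u i * A i b = (k == b)%:R.
  have := congr1 (fun X : 'M_N => X (enum_rank k) (enum_rank b)) (mulVmx Munit).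
  rewrite !mxE (inj_eq enum_rank_inj) => <-.
  by rewrite sumT; apply: eq_bigr => j _; rewrite !mxE /u enum_valK enum_rankK.
have <- : \sum_i \sum_j u i * A i j * v j = v k.
  rewrite exchange_big /=; under eq_bigr do rewrite -big_distrl /= uA.
  rewrite (bigD1 k) //= eqxx mul1r big1 ?addr0 // => b.
  by rewrite eq_sym => /negbTE ->; rewrite mul0r.
exact: psd_cauchy_schwarz.
Qed.

End QuadraticForms.

(** * Extension of positive functionals *)

Section RieszExtension.
Variables (R : realType) (V : lmodType R).
Implicit Types (F P : V -> Prop) (phi : V -> R).

Definition is_subspace F : Prop :=
  F 0 /\ forall a u v, F u -> F v -> F (a *: u + v).

Definition is_cone P : Prop :=
  (forall u v, P u -> P v -> P (u + v)) /\ (forall a u, 0 <= a -> P u -> P (a *: u)).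

Definition linear_on F phi : Prop :=
  forall a u v, F u -> F v -> phi (a *: u + v) = a * phi u + phi v.

Definition adjoin F (e : V) : V -> Prop := fun v => exists a, F (v - a *: e).

Lemma is_subspaceZ F a u : is_subspace F -> F u -> F (a *: u).
Proof. by move=> [F0 FD] Fu; rewrite -[_ *: _]addr0; apply: FD. Qed.

Lemma is_subspaceD F u v : is_subspace F -> F u -> F v -> F (u + v).
Proof. by move=> [F0 FD] Fu Fv; rewrite -[u]scale1r; apply: FD. Qed.

Lemma is_subspaceB F u v : is_subspace F -> F u -> F v -> F (u - v).
Proof. by move=> [F0 FD] Fu Fv; rewrite addrC -scaleN1r; apply: FD. Qed.

Lemma linear_onD F phi u v : linear_on F phi -> F u -> F v -> phi (u + v) = phi u + phi v.
Proof. by move=> lin Fu Fv; rewrite -{1}[u]scale1r lin // mul1r. Qed.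

Lemma linear_on0 F phi : is_subspace F -> linear_on F phi -> phi 0 = 0.
Proof.
move=> [F0 _] lin; apply: (@addrI _ (phi 0)).
by rewrite -(linear_onD lin) // !addr0.
Qed.

Lemma linear_onZ F phi a u : is_subspace F -> linear_on F phi -> F u -> phi (a *: u) = a * phi u.
Proof.
move=> sF lin Fu; rewrite -[a *: u]addr0 lin ?(linear_on0 sF) ?addr0 //.
exact: sF.1.
Qed.

Lemma adjoin_subspace F e : is_subspace F -> is_subspace (adjoin F e).
Proof.
move=> sF; split=> [|a u v [b Fb] [c Fc]].
  by exists 0; rewrite scale0r subr0; apply: sF.1.
exists (a * b + c).
suff -> : a *: u + v - (a * b + c) *: e = a *: (u - b *: e) + (v - c *: e) by apply: sF.2.
by rewrite scalerBr scalerA scalerDl opprD addrACA.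
Qed.

(** A value [c] at [e] is admissible when it lies above every [- phi u] with [P (u + e)] and below
    every [phi u] with [P (u - e)]. Adding two such cone elements shows that the bounds are
    compatible; the last two hypotheses make both families nonempty, so the supremum of the lower
    bounds serves. *)
Lemma riesz_step F P phi e :
  is_subspace F -> is_cone P -> linear_on F phi ->
  (forall v, F v -> P v -> 0 <= phi v) ->
  (exists2 u, F u & P (u + e)) -> (exists2 u, F u & P (u - e)) ->
  exists psi, [/\ linear_on (adjoin F e) psi, forall v, F v -> psi v = phi v
                & forall v, adjoin F e v -> P v -> 0 <= psi v].
Proof.
move=> sF [PD PZ] lin pos [u1 Fu1 Pu1] [u2 Fu2 Pu2].
(* If [e] is already in [F], nothing is adjoined and [phi] itself works; otherwise the coefficient
   along [e] is unique. *)
have [Fe|Fe] := pselect (F e).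
  have FE v : adjoin F e v -> F v.
    move=> [a Fa]; rewrite -[v](subrK (a *: e)).
    by apply: is_subspaceD => //; apply: is_subspaceZ.
  by exists phi; split=> // [a u v /FE Fu /FE Fv|v /FE Fv]; [exact: lin | exact: pos].
pose A : set R := [set x | exists u, [/\ F u, P (u + e) & x = - phi u]]%classic.
have A_ub v : F v -> P (v - e) -> ubound A (phi v).
  move=> Fv Pv _ [u [Fu Pu ->]]; rewrite -subr_ge0 opprK addrC -(linear_onD lin) //.
  by apply: pos; [exact: is_subspaceD | have := PD _ _ Pu Pv; rewrite addrACA subrr addr0].
have A_sup : has_sup A.
  by split; [exists (- phi u1), u1 | exists (phi u2); apply: A_ub].
pose c := sup A.
have c_ge u : F u -> P (u + e) -> 0 <= phi u + c.
  move=> Fu Pu; rewrite addrC -[X in c + X]opprK subr_ge0.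
  by apply: ub_le_sup; [exact: A_sup.2 | exists u].
have c_le u : F u -> P (u - e) -> 0 <= phi u - c.
  by move=> Fu Pu; rewrite subr_ge0; apply: ge_sup; [exact: A_sup.1 | exact: A_ub].
(* The default 0 only concerns vectors outside [adjoin F e]. *)
pose coef v : R := if pselect (exists a, F (v - a *: e)) is left h then projT1 (cid h) else 0.
have coefE v a : F (v - a *: e) -> coef v = a.
  move=> Fa; rewrite /coef; case: pselect => [h|[]]; last by exists a.
  case: cid => b /= Fb; apply/eqP; apply: contra_notT Fe => ab.
  rewrite -[e](@scalerK _ _ (a - b)); last by rewrite subr_eq0 eq_sym.
  apply: is_subspaceZ => //.
  suff -> : (a - b) *: e = (v - b *: e) - (v - a *: e) by apply: is_subspaceB.
  by rewrite scalerBl opprB [RHS]addrC addrA subrK.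
exists (fun v => phi (v - coef v *: e) + coef v * c); split.
- move=> a u v [b Fb] [d Fd].
  have Fuv : F (a *: (u - b *: e) + (v - d *: e)) by apply: sF.2.
  have E : a *: (u - b *: e) + (v - d *: e) = a *: u + v - (a * b + d) *: e.
    by rewrite scalerBr scalerA scalerDl opprD addrACA.
  rewrite (coefE u b) // (coefE v d) // (coefE (a *: u + v) (a * b + d)) -?E //.
  by rewrite lin //; ring.
- move=> v Fv; rewrite (coefE v 0) ?scale0r ?subr0 // mul0r addr0 //.
- move=> v [a Fa] Pv; rewrite (coefE v a) //; set u := v - a *: e in Fa *.
  have vE : v = u + a *: e by rewrite subrK.
  (* Dividing by the absolute value of [a] reduces to the two inequalities that define [c]. *)
  have [a0|a0|a0] := ltgtP a 0.
  + have Pu : P ((- a)^-1 *: u - e).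
      have := PZ (- a)^-1 v; rewrite vE scalerDr scalerA invrN mulNr mulVf ?lt_eqF // scaleN1r.
      by apply; rewrite -?vE // -invrN invr_ge0; lra.
    have := c_le _ (is_subspaceZ (- a)^-1 sF Fa) Pu; rewrite (linear_onZ _ sF lin) //.
    have a' : 0 < - a by lra.
    rewrite -(pmulr_rge0 _ a') mulrBr mulrA mulfV ?gt_eqF // mul1r; lra.
  + have Pu : P (a^-1 *: u + e).
      have := PZ a^-1 v; rewrite vE scalerDr scalerA mulVf ?gt_eqF // scale1r.
      by apply; rewrite -?vE // invr_ge0 ltW.
    have := c_ge _ (is_subspaceZ a^-1 sF Fa) Pu; rewrite (linear_onZ _ sF lin) //.
    by rewrite -(pmulr_rge0 _ a0) mulrDr mulrA mulfV ?gt_eqF // mul1r.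
  + rewrite a0 mul0r addr0; apply: pos => //.
    by rewrite /u a0 scale0r subr0.
Qed.

(** The vectors of [s] are adjoined one at a time, so finite induction takes the place of Zorn's
    lemma. The domination hypotheses survive because the subspace only grows. *)
Lemma riesz_extension (s : seq V) F P phi :
  is_subspace F -> is_cone P -> linear_on F phi ->
  (forall v, F v -> P v -> 0 <= phi v) ->
  (forall e, e \in s ->
     (exists2 u, F u & P (u + e)) /\ (exists2 u, F u & P (u - e))) ->
  exists F' psi, [/\ is_subspace F', linear_on F' psi,
     forall v, F v -> F' v /\ psi v = phi v, forall e, e \in s -> F' e
   & forall v, F' v -> P v -> 0 <= psi v].
Proof.
elim: s F phi => [|e s IH] F phi sF cP lin pos dom; first by exists F, phi; split.
have [dom1 dom2] := dom e (mem_head _ _).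
have [psi [lin1 eq1 pos1]] := riesz_step sF cP lin pos dom1 dom2.
have sub v : F v -> adjoin F e v by exists 0; rewrite scale0r subr0.
have [x xs|F' [psi' [sF' lin' eq' mem' pos']]] :=
    IH _ _ (adjoin_subspace e sF) cP lin1 pos1.
  have [|[u1 Fu1 Pu1] [u2 Fu2 Pu2]] := dom x; first by rewrite inE xs orbT.
  by split; [exists u1 | exists u2] => //; apply: sub.
exists F', psi'; split=> // [v Fv|x].
  by have [F'v ->] := eq' v (sub _ Fv); rewrite eq1.
rewrite inE => /predU1P[->|/mem' //]; apply: (eq' e _).1.
by exists 1; rewrite scale1r subrr; apply: sF.1.
Qed.

End RieszExtension.

(** * Representation of nonnegative functionals by positive semidefinite matrices *)

Section ConicDuality.
Variables (R : realType) (T : finType).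

(** The definite matrix [M] acts as an order unit: a multiple of it dominates plus and minus each
    elementary matrix, which is what the Riesz extension requires. The values of the extension at
    the elementary matrices are the entries of [H]. *)
Lemma psd_functional_extension (F : (T -> T -> R) -> Prop) (phi : (T -> T -> R) -> R)
    (M : T -> T -> R) :
  F (fun _ _ => 0) ->
  (forall a A B, F A -> F B -> F (fun i j => a * A i j + B i j)) ->
  (forall a A B, F A -> F B -> phi (fun i j => a * A i j + B i j) = a * phi A + phi B) ->
  (forall A, F A -> (forall v, 0 <= qform A v) -> 0 <= phi A) ->
  F M -> psd R T M -> (forall v, qform M v = 0 -> forall i, v i = 0) ->
  exists2 H, psd R T H & forall A, F A -> phi A = \sum_i \sum_j H i j * A i j.
Proof.
move=> F0 FD lin pos FM Mpsd Mdef.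
pose V : lmodType R := {ffun T * T -> R^o}.
pose mx (v : V) i j : R := v (i, j).
pose vec (A : T -> T -> R) : V := [ffun x => A x.1 x.2].
have mxK A : mx (vec A) = A.
  by apply/funext => i; apply/funext => j; rewrite /mx ffunE.
have mxD a (u v : V) : mx (a *: u + v) = (fun i j => a * mx u i j + mx v i j).
  by apply/funext => i; apply/funext => j; rewrite /mx !ffunE.
have mxZ a (u : V) : mx (a *: u) = (fun i j => a * mx u i j).
  by apply/funext => i; apply/funext => j; rewrite /mx !ffunE.
have mxS (u v : V) : mx (u + v) = (fun i j => mx u i j + mx v i j).
  by apply/funext => i; apply/funext => j; rewrite /mx !ffunE.
(* Symmetry is not demanded in this cone, so it contains all skew-symmetric matrices; this will
   force [H] to be symmetric. *)
pose P (v : V) := forall x, 0 <= qform (mx v) x.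
have Pcone : is_cone P.
  split=> [u v Pu Pv x|a u a0 Pu x]; first by rewrite mxS qformD addr_ge0.
  by rewrite mxZ qformZ mulr_ge0.
have Fsub : is_subspace (F \o mx).
  split=> [|a u v Fu Fv] /=; last by rewrite mxD; apply: FD.
  rewrite [mx 0](_ : _ = (fun _ _ => 0)) //.
  by apply/funext => i; apply/funext => j; rewrite /mx ffunE.
have philin : linear_on (F \o mx) (phi \o mx).
  by move=> a u v Fu Fv /=; rewrite mxD lin.
pose E (p : T * T) : V := [ffun x => (x == p)%:R].
have qE p x : qform (mx (E p)) x = x p.1 * x p.2.
  case: p => k l; rewrite /qform /mx /= (bigD1 k) //= [X in _ + X]big1 ?addr0.
    rewrite (bigD1 l) //= big1 ?addr0; first by rewrite !ffunE eqxx mulr1.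
    by move=> j /negbTE jl; rewrite !ffunE xpair_eqE jl andbF mulr0 mul0r.
  by move=> i /negbTE ik; rewrite big1 // => j _; rewrite !ffunE xpair_eqE ik mulr0 mul0r.
have dom e : e \in [seq E p | p : T * T] ->
    (exists2 u, (F \o mx) u & P (u + e)) /\ (exists2 u, (F \o mx) u & P (u - e)).
  move=> /mapP[[k l] _ ->].
  (* The form of the elementary matrix is [x k * x l], at most half of [x k ^+ 2 + x l ^+ 2] in
     absolute value. *)
  have [t t0 tP] := posdef_coord_bound Mpsd Mdef k.
  have [s s0 sP] := posdef_coord_bound Mpsd Mdef l.
  have Ft : F (mx ((t + s) *: vec M)).
    rewrite -[_ *: _]addr0; apply: Fsub.2; last exact: Fsub.1.
    by rewrite /= mxK.
  have bnd x : x k ^+ 2 + x l ^+ 2 <= (t + s) * qform M x.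
    by rewrite mulrDl lerD.
  have Mx0 x : 0 <= qform M x by apply: Mpsd.2.
  split; exists ((t + s) *: vec M) => // x.
    rewrite mxS qformD mxZ mxK qformZ qE /=; have := bnd x.
    have := sqr_ge0 (x k + x l); rewrite sqrrD mulr2n.
    have := sqr_ge0 (x k); have := sqr_ge0 (x l); lra.
  have -> : - E (k, l) = (-1) *: E (k, l) by rewrite scaleN1r.
  rewrite mxS qformD !mxZ mxK !qformZ qE /=; have := bnd x.
  have := sqr_ge0 (x k - x l); rewrite sqrrB mulr2n.
  have := sqr_ge0 (x k); have := sqr_ge0 (x l); lra.
have [//|F' [psi [sF' lin' ext' gen' pos']]] := riesz_extension Fsub Pcone philin _ dom.
  by move=> v Fv Pv; apply: pos.
have sumE (v : V) : v = \sum_p v p *: E p.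
  apply/ffunP => x; rewrite sum_ffunE (bigD1 x) //= big1 ?addr0.
    by rewrite !ffunE eqxx [_ *: _]mulr1.
  by move=> p px; rewrite !ffunE eq_sym (negbTE px) [_ *: _]mulr0.
have F'E p : F' (E p) by apply: gen'; apply/mapP; exists p; rewrite ?mem_enum.
have psiE (v : V) : F' v /\ psi v = \sum_p v p * psi (E p).
  rewrite {1 2}(sumE v); elim/big_rec2: _ => [|p y w _ [F'w psiw]].
    by split; [exact: sF'.1 | exact: linear_on0 sF' lin'].
  by split; [exact: sF'.2 | rewrite lin' // psiw].
pose H i j := psi (E (i, j)).
have HE A : psi (vec A) = \sum_i \sum_j H i j * A i j.
  rewrite (psiE _).2 pair_bigA /=; apply: eq_bigr => -[i j] _.
  by rewrite ffunE /= mulrC.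
have Hpos A : (forall v, 0 <= qform A v) -> 0 <= \sum_i \sum_j H i j * A i j.
  by move=> Apos; rewrite -HE; apply: pos'; [exact: (psiE _).1 | rewrite /P mxK].
exists H; last first.
  by move=> A FA; rewrite -HE; have [|_ ->] := ext' (vec A); rewrite /= mxK.
split=> [i j|v].
  (* Skew-symmetric matrices have zero quadratic form, hence are orthogonal to H. *)
  pose K (c : R) a b := c * (mx (E (i, j)) a b - mx (E (j, i)) a b).
  have Kq c v : qform (K c) v = 0.
    rewrite /K qformZ; have -> : (fun a b => mx (E (i, j)) a b - mx (E (j, i)) a b)
      = mx (E (i, j) + (-1) *: E (j, i)).
      by rewrite mxS mxZ; apply/funext => a; apply/funext => b; rewrite mulN1r.
    rewrite mxS qformD mxZ qformZ !qE /=; ring.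
  have KH c : \sum_a \sum_b H a b * K c a b = c * (H i j - H j i).
    rewrite -HE; have -> : vec (K c) = c *: (E (i, j) + (-1) *: E (j, i)).
      by apply/ffunP => -[a b]; rewrite /K /mx !ffunE /= scaleN1r.
    rewrite (linear_onZ _ sF' lin'); last first.
      by apply: is_subspaceD => //; apply: is_subspaceZ.
    rewrite (linear_onD lin') //; last exact: is_subspaceZ.
    by rewrite (linear_onZ _ sF' lin') // mulN1r.
  have h1 : 0 <= 1 * (H i j - H j i) by rewrite -KH; apply: Hpos => v; rewrite Kq.
  have h2 : 0 <= -1 * (H i j - H j i) by rewrite -KH; apply: Hpos => v; rewrite Kq.
  by lra.
(* The form of [H] at [v] is its pairing with a rank-one matrix of the cone. *)
have -> : \sum_i \sum_j v i * H i j * v j = \sum_i \sum_j H i j * (v i * v j).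
  by apply: eq_bigr => i _; apply: eq_bigr => j _; ring.
by apply: Hpos => x; rewrite qform_rank1 sqr_ge0.
Qed.

End ConicDuality.

(** * Polynomials and moments *)

(** Reduction modulo [D] isolates the lowest digit; the others follow by induction after division by
    [D]. *)
Lemma base_digits_inj D n (a b : 'I_n -> nat) :
  (forall i, a i < D)%N -> (forall i, b i < D)%N ->
  (\sum_i a i * D ^ i = \sum_i b i * D ^ i)%N -> a =1 b.
Proof.
have split_low k (c : 'I_k.+1 -> nat) :
    (\sum_i c i * D ^ i = (\sum_(i < k) c (lift ord0 i) * D ^ i) * D + c ord0)%N.
  rewrite big_ord_recl expn0 muln1 addnC big_distrl; congr addn.
  by apply: eq_bigr => i _ /=; rewrite expnS -mulnA [(D * _)%N]mulnC.
elim: n a b => [|n IH] a b aD bD; first by move=> _ [].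
rewrite !split_low => E.
have D0 : (0 < D)%N := leq_ltn_trans (leq0n _) (aD ord0).
have a0 : a ord0 = b ord0.
  by have := congr1 (modn^~ D) E; rewrite /= !modnMDl !modn_small.
move/eqP: E; rewrite a0 eqn_add2r eqn_pmul2r // => /eqP E i.
have := IH (fun i => a (lift ord0 i)) (fun i => b (lift ord0 i)) (fun i => aD _) (fun i => bD _) E.
by move=> ab; have [j ->|->] := unliftP ord0 i.
Qed.

Lemma base_digits_lt D n (a : 'I_n -> nat) :
  (forall i, a i < D)%N -> (\sum_i a i * D ^ i < D ^ n)%N.
Proof.
elim: n a => [|n IH] a aD; first by rewrite big_ord0.
have := IH (fun i => a (widen_ord (leqnSn n) i)) (fun i => aD _).
rewrite big_ord_recr /= expnS => lt1; have := aD ord_max; nia.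
Qed.

Section PolynomialsOnCurves.
Variables (R : realType) (n : nat).
Implicit Types (p : {mpoly R[n]}) (x : 'I_n -> R).

Lemma monic_prod_size (I : Type) (s : seq I) (F : I -> {poly R}) (d : I -> nat) :
  (forall i, F i \is monic /\ size (F i) = (d i).+1) ->
  \prod_(i <- s) F i \is monic /\ size (\prod_(i <- s) F i) = (\sum_(i <- s) d i).+1.
Proof.
move=> Fd; elim: s => [|i s [mon sz]]; first by rewrite !big_nil monic1 size_poly1.
have [moni szi] := Fd i; rewrite !big_cons; split; first by rewrite monicMl.
by rewrite size_Mmonic ?monic_neq0 // szi sz addnS.
Qed.

(** The monomial [a] restricted to the curve with coordinates [x i + t ^+ (D ^ i)], as a univariate
    polynomial in [t]. *)
Definition curve_poly D x (a : 'X_{1..n}) : {poly R} :=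
  \prod_(i < n) ('X^(D ^ i) + (x i)%:P) ^+ a i.

Lemma curve_poly_monic D x a : (0 < D)%N ->
  curve_poly D x a \is monic /\ size (curve_poly D x a) = (\sum_(i < n) a i * D ^ i).+1.
Proof.
move=> D0; apply: (@monic_prod_size _ _ _ (fun i : 'I_n => a i * D ^ i)%N) => i.
have Di : (0 < D ^ i)%N by rewrite expn_gt0 D0.
split; first by rewrite monic_exp // monicXnaddC.
have := monic_prod_size (nseq (a i) i) (F := fun i : 'I_n => 'X^(D ^ i) + (x i)%:P)
  (d := fun i : 'I_n => (D ^ i)%N).
rewrite !big_nseq iter_mulr_1 iter_addn_0 mulnC; case=> // k.
by rewrite monicXnaddC ?size_XnaddC // expn_gt0 D0.
Qed.

(* Along this curve the monomial [a] becomes monic in [t], of degree the number with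
   base-[D] digits [a i]; distinct monomials get distinct degrees, so the leading
   term does not cancel. *)
Lemma mpoly_curve D x p : (0 < D)%N -> p != 0 -> (msize p <= D)%N ->
  exists q : {poly R}, [/\ q != 0, (size q <= D ^ n)%N &
    forall t, q.[t] = p.@[fun i => x i + t ^+ (D ^ i)]].
Proof.
move=> D0 p0 pD.
have aD a : a \in msupp p -> forall i, (a i < D)%N.
  move=> ap i; rewrite (leq_trans _ pD) // (leq_ltn_trans _ (msize_mdeg_lt ap)) //.
  by rewrite mdegE (bigD1 i) //= leq_addr.
pose wt (a : 'X_{1..n}) := (\sum_(i < n) a i * D ^ i)%N.
have size_curve a : size (curve_poly D x a) = (wt a).+1 by have [] := curve_poly_monic x a D0.
exists (\sum_(a <- msupp p) p@_a *: curve_poly D x a); split.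
- have [a ap amax] : exists2 a, a \in msupp p & forall b, b \in msupp p -> (wt b <= wt a)%N.
    have : msupp p != [::] by rewrite msupp_eq0.
    elim: (msupp p) => // a s IH _; have [->|/IH[b bs bmax]] := eqVneq s [::].
      by exists a; rewrite ?mem_head // => b; rewrite inE => /eqP ->.
    have [ab|ba] := leqP (wt a) (wt b).
      by exists b; rewrite ?inE ?bs ?orbT // => c /predU1P[->|/bmax].
    exists a; rewrite ?mem_head // => c /predU1P[->//|/bmax cb].
    exact: leq_trans cb (ltnW ba).
  apply/eqP => /(congr1 (fun q : {poly R} => q`_(wt a))).
  rewrite coef0 coef_sum (bigD1_seq a) ?msupp_uniq //= big_seq_cond big1 ?addr0.
    have [mon _] := curve_poly_monic x a D0; rewrite coefZ.
    have -> : (curve_poly D x a)`_(wt a) = 1.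
      by rewrite -[RHS](monicP mon) lead_coefE size_curve.
    by rewrite mulr1 => pa0; move: ap; rewrite mcoeff_msupp pa0 eqxx.
  move=> b /andP[bp ba]; rewrite coefZ nth_default ?mulr0 // size_curve ltn_neqAle amax // andbT.
  apply: contraNneq ba => wab; apply/eqP/mnmP; apply: (base_digits_inj (D := D)) wab; exact: aD.
- rewrite big_seq; apply: (leq_trans (size_sum _ _ _)); apply/bigmax_leqP_seq => a ap _.
  apply: leq_trans (size_scale_leq _ _) _; rewrite size_curve; apply: base_digits_lt; exact: aD.
- move=> t; rewrite horner_sum mevalE; apply: eq_bigr => a _.
  rewrite hornerZ horner_prod; congr (_ * _); apply: eq_bigr => i _.
  by rewrite horner_exp hornerD hornerXn hornerC addrC.
Qed.

(** The points lie on the curve through [x], at [D ^ n] distinct small parameters. A nonzero [p]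
    restricts to a nonzero univariate polynomial of degree below [D ^ n], which cannot vanish at all
    of them. *)
Lemma local_determining_points D x (e : R) : 0 < e ->
  exists (K : nat) (pt : nat -> 'I_n -> R), (forall k i, `|pt k i - x i| < e) /\
    forall p, (msize p <= D)%N -> (forall k, (k < K)%N -> p.@[pt k] = 0) -> p = 0.
Proof.
move=> e0; have [->|D0] := posnP D.
  by exists 0%N, (fun _ => x); split=> [k i|p]; [rewrite subrr normr0 | rewrite leqn0 msize_poly_eq0 => /eqP].
(* The bound 1 gives [t ^+ (D ^ i) <= t], and [e / 2] keeps the distance strictly below [e]. *)
pose d := Num.min 1 (e / 2); have d0 : 0 < d by rewrite lt_min ltr01 divr_gt0.
pose t (k : nat) : R := d / k.+1%:R.
have t0 k : 0 < t k by rewrite divr_gt0.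
have td k : t k <= d by rewrite ler_pdivrMr // ler_peMr ?ler1n // ltW.
have t_inj : injective t.
  move=> j k; rewrite /t => /(mulfI (lt0r_neq0 d0)) /invr_inj /eqP.
  by rewrite eqr_nat => /eqP[].
exists (D ^ n)%N, (fun k i => x i + t k ^+ (D ^ i)); split=> [k i|p pD p0].
  rewrite [x i + _]addrC addrK ger0_norm ?exprn_ge0 ?ltW //.
  have d1 : d <= 1 by rewrite ge_min lexx.
  have d2 : d <= e / 2 by rewrite ge_min lexx orbT.
  have Di : (1 <= D ^ i)%N by rewrite expn_gt0 D0.
  have := ler_wiXn2l (ltW (t0 k)) (le_trans (td k) d1) Di.
  by have := td k; rewrite expr1; lra.
apply/eqP; apply: contraT => pn0.
have [q [q0 szq qE]] := mpoly_curve x D0 pn0 pD.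
have : (size [seq t k | k <- iota 0 (D ^ n)] < size q)%N.
  apply: max_poly_roots => //; last by rewrite map_inj_uniq ?iota_uniq.
  by apply/allP => _ /mapP[k + ->]; rewrite mem_iota /root qE => /p0 ->.
by rewrite size_map size_iota ltnNge szq.
Qed.

End PolynomialsOnCurves.

(** * The functional [L_y] and moments of finitely many points *)

Section RieszFunctional.
Variables (R : realType) (n : nat).
Implicit Types (p G : {mpoly R[n]}) (y : 'X_{1..n} -> R).

Lemma LyMX y p a : Ly R n y (p * 'X_[a]) = \sum_(d <- msupp p) p@_d * y (a + d)%MM.
Proof.
rewrite /Ly (perm_big _ (msuppMX p a)) big_map; apply: eq_bigr => d _.
by rewrite mcoeffMX.
Qed.

Lemma Ly_eq y z p : (forall a, a \in msupp p -> y a = z a) -> Ly R n y p = Ly R n z p.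
Proof. by move=> yz; apply: eq_big_seq => a /yz ->. Qed.

Lemma LyD_y a y z p : Ly R n (fun c => a * y c + z c) p = a * Ly R n y p + Ly R n z p.
Proof.
by rewrite /Ly big_distrr -big_split; apply: eq_bigr => c _ /=; ring.
Qed.

(** Used to read coefficient equations off identities between functionals of moments. *)
Lemma Ly_dirac a p : Ly R n (fun c => (c == a)%:R) p = p@_a.
Proof.
rewrite /Ly; have [ap|ap] := boolP (a \in msupp p).
  rewrite (bigD1_seq a) ?msupp_uniq //= eqxx mulr1 big1 ?addr0 // => c /negbTE ->.
  by rewrite mulr0.
rewrite memN_msupp_eq0 // big_seq big1 // => c cp.
by rewrite (negbTE (memPn ap c cp)) mulr0.
Qed.

(** A common index set, independent of the support of [p], allows sums for several polynomials to be
    interchanged. *)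
Lemma Ly_coef_sum D (y : 'X_{1..n} -> R) p : (msize p <= D.+1)%N ->
  Ly R n y p = \sum_(a : Idx n D) p@_(val a) * y (val a).
Proof.
move=> pD; rewrite /Ly.
have aD a : a \in msupp p -> (mdeg a < D.+1)%N.
  by move=> ap; rewrite (leq_trans (msize_mdeg_lt ap)).
transitivity (\sum_(a <- msupp p) \sum_(b : Idx n D) (val b == a)%:R * (p@_(val b) * y (val b))).
  apply: eq_big_seq => a /aD aD'; pose a' : Idx n D := BMultinom aD'.
  rewrite (bigD1 a') //= eqxx mul1r big1 ?addr0 // => b ba.
  have -> : (val b == a) = (b == a') by rewrite bmeqP.
  by rewrite (negbTE ba) mul0r.
rewrite exchange_big /=; apply: eq_bigr => b _; rewrite -big_distrl /=.
have [bp|bp] := boolP (bmnm b \in msupp p); last by rewrite memN_msupp_eq0 // !mul0r mulr0.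
rewrite (bigD1_seq (bmnm b)) ?msupp_uniq //= eqxx big1 ?addr0 ?mul1r // => a ab.
by rewrite (_ : (val b == a) = false) // eq_sym; apply: negbTE.
Qed.

Lemma Ly_monomial (y : 'X_{1..n} -> R) a : Ly R n y 'X_[a] = y a.
Proof. by rewrite /Ly msuppX big_seq1 mcoeffX eqxx mul1r. Qed.

(** Moments of the sum of the Dirac measures at the first [K] points; the total mass is [K], not
    1. *)
Definition point_moments (K : nat) (pt : nat -> 'I_n -> R) : 'X_{1..n} -> R :=
  fun a => \sum_(k < K) \prod_i pt k i ^+ a i.

Lemma Ly_point_moments K pt p : Ly R n (point_moments K pt) p = \sum_(k < K) p.@[pt k].
Proof.
rewrite /Ly; under eq_bigr do rewrite big_distrr /=.
by rewrite exchange_big; apply: eq_bigr => k _; rewrite mevalE.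
Qed.

Definition idx_poly k (v : Idx n k -> R) : {mpoly R[n]} := \sum_b v b *: 'X_[val b].

Lemma qform_point_moments K pt G k (v : Idx n k -> R) :
  qform (fun b c => Ly R n (point_moments K pt) (G * 'X_[val b + val c])) v
  = \sum_(l < K) G.@[pt l] * (idx_poly v).@[pt l] ^+ 2.
Proof.
rewrite /qform.
under eq_bigr do under eq_bigr do rewrite Ly_point_moments big_distrr big_distrl /=.
under eq_bigr do rewrite exchange_big /=.
rewrite exchange_big /=; apply: eq_bigr => l _.
have -> : (idx_poly v).@[pt l] = \sum_b v b * ('X_[val b]).@[pt l].
  by rewrite /idx_poly raddf_sum /=; apply: eq_bigr => b _; rewrite mevalZ.
transitivity (\sum_b \sum_c
    G.@[pt l] * ((v b * ('X_[bmnm b]).@[pt l]) * (v c * ('X_[bmnm c]).@[pt l]))).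
  apply: eq_bigr => b _; apply: eq_bigr => c _.
  rewrite mevalM mpolyXD mevalM.
  by ring.
move: (G.@[pt l]) => w; rewrite expr2 big_distrlr big_distrr /=.
by apply: eq_bigr => b _; rewrite [RHS]big_distrr.
Qed.

Lemma msize_idx_poly k (v : Idx n k -> R) : (msize (idx_poly v) <= k.+1)%N.
Proof.
apply: leq_trans (msize_sum _ _ _) _; apply/bigmax_leqP => b _.
by rewrite (leq_trans (msizeZ_le _ _)) // msizeX bmdeg.
Qed.

Lemma idx_poly_eq0 k (v : Idx n k -> R) : idx_poly v = 0 -> forall b, v b = 0.
Proof.
move=> v0 b; have := congr1 (mcoeff (val b)) v0.
rewrite mcoeff0 /idx_poly raddf_sum (bigD1 b) //= big1 ?addr0.
  by rewrite mcoeffZ mcoeffX eqxx mulr1.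
by move=> c cb; rewrite mcoeffZ mcoeffX (inj_eq val_inj) (negbTE cb) mulr0.
Qed.

(** Variables are moved from [a] to [c] one at a time. With [k = l = r] this factors a monomial of
    degree at most [2r] into two basis monomials. *)
Lemma mnm_split (a : 'X_{1..n}) k l : (mdeg a <= k + l)%N ->
  exists b c, [/\ (mdeg b <= k)%N, (mdeg c <= l)%N & a = (b + c)%MM].
Proof.
elim: l a => [|l IH] a; first by rewrite addn0; exists a, 0%MM; rewrite mdeg0 addm0.
have [-> _|a0 al] := eqVneq a 0%MM; first by exists 0%MM, 0%MM; rewrite !mdeg0 addm0.
have [i ai] : exists i, (0 < a i)%N.
  apply/existsP; apply: contraNT a0 => /existsPn a0; apply/eqP/mnmP => i.
  by rewrite mnm0E; have := a0 i; case: (a i).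
pose a' := (a - U_(i))%MM.
have aE : a = (a' + U_(i))%MM.
  by apply/mnmP => j; rewrite mnmDE mnmBE mnm1E; case: eqP => [<-|_]; lia.
have [|b [c [bk cl a'E]]] := IH a'; first by move: al; rewrite aE mdegD mdeg1; lia.
by exists b, (c + U_(i))%MM; rewrite mdegD mdeg1 addn1 aE a'E addmA.
Qed.

End RieszFunctional.

(** * Sparsity graphs *)

Section Graphs.
Variable n : nat.
Implicit Types G H : graph n.

Lemma subgraph_trans G H K : subgraph n G H -> subgraph n H K -> subgraph n G K.
Proof. by move=> [GV GE] [HV HE]; split=> [a /GV/HV|a b /GE/HE]. Qed.

Lemma subgraph_inpat G H a b : subgraph n G H -> inpat n G a b -> inpat n H a b.
Proof. by move=> [_ GE] [->|/GE ab]; [left | right]. Qed.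

Lemma subgraph_gsupp G H : subgraph n G H -> (gsupp n G `<=` gsupp n H)%classic.
Proof.
move=> [GV GE] _ [a [b [[[ab /GV Va]|/GE Eab] ->]]]; exists a, b; split=> //; last by right.
by left.
Qed.

Lemma finite_Nk k : finite_set (Nk n k).
Proof.
have -> : Nk n k = [set val b | b in @setT (Idx n k)]%classic.
  apply/seteqP; split=> [a ak|_ [b _ <-]]; last by rewrite /Nk /= -ltnS bmdeg.
  by exists (BMultinom (ak : (mdeg a < k.+1)%N)).
exact/finite_image/finite_finset.
Qed.

Lemma gconnectedP G a b :
  gconnected n G a b <-> exists2 s, path (fun x y => `[< gE G x y >]) a s & last a s = b.
Proof.
split=> [[s [sE sl]]|[s sE sl]]; exists s => //.
  by apply/(pathP a) => i /sE; rewrite asboolE.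
by split=> // i /(pathP a sE) /asboolP.
Qed.

Lemma gconnected_refl G a : gconnected n G a a.
Proof. by exists [::]. Qed.

Lemma gconnected_trans G a b c :
  gconnected n G a b -> gconnected n G b c -> gconnected n G a c.
Proof.
move=> /gconnectedP[s sE sl] /gconnectedP[t tE tl]; apply/gconnectedP.
by exists (s ++ t); rewrite ?cat_path ?last_cat ?sl ?sE.
Qed.

Lemma gconnected_edge G a b : gE G a b -> gconnected n G a b.
Proof. by move=> ab; apply/gconnectedP; exists [:: b] => //=; rewrite andbT; apply/asboolP. Qed.

Lemma gconnected_sym G a b : (forall x y, gE G x y -> gE G y x) ->
  gconnected n G a b -> gconnected n G b a.
Proof.
move=> Gsym /gconnectedP[s sE <-]; elim: s a sE => [|c s IH] a /=.
  by move=> _; exact: gconnected_refl.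
move=> /andP[/asboolP ac /IH ?]; apply: gconnected_trans (_ : gconnected n G c a) => //.
exact/gconnected_edge/Gsym.
Qed.

Lemma gconnected_mono G H a b :
  subgraph n G H -> gconnected n G a b -> gconnected n H a b.
Proof.
move=> [_ GE] /gconnectedP[s sE sl]; apply/gconnectedP; exists s => //.
by apply: sub_path sE => x y /asboolP/GE xy; apply/asboolP.
Qed.

(** Components become cliques, so vertices 0 and 2 of a cycle of length at least four span a chord.
    Monotonicity holds because walks of a subgraph are walks of the larger graph. *)
Lemma max_chordal_ext_valid : valid_chordal_ext (@max_chordal_ext n).
Proof.
split=> [G [Gfin [GV Gsym]]|G H _ _ GH]; last first.
  split=> [a|a b [ab [Va [Vb c]]]]; first exact: GH.1.
  split=> //; split; first exact: GH.1.
  by split; [exact: GH.1 | exact: gconnected_mono c].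
split=> //.
- split=> //; split=> [a b [ab [Va [Vb _]]] //|a b [ab [Va [Vb c]]]].
  by split; [exact/nesym | split=> //; split=> //; exact: gconnected_sym].
- by move=> a b ab; have [? [? ?]] := GV a b ab; split=> //; split=> //; split=> //; apply: gconnected_edge.
- move=> s s4 s_uniq sV sE.
  have e01 := sE 0%N (leq_trans (isT : (1 <= 4)%N) s4).
  have e12 := sE 1%N (leq_trans (isT : (2 <= 4)%N) s4).
  rewrite !modn_small in e01 e12; try by lia.
  exists 0%N, 2%N; split; [by lia | split; [by lia | split; [by lia |]]].
  split; first by apply/eqP; rewrite nth_uniq ?(leq_trans _ s4).
  split; first by apply: sV; apply: mem_nth; exact: leq_trans s4.
  split; first by apply: sV; apply: mem_nth; exact: leq_trans s4.
  exact: gconnected_trans e01.2.2.2 e12.2.2.2.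
Qed.

End Graphs.

(** * Monotonicity of the term sparsity graphs in [s] and [r] *)

Section SparsityGraphs.
Variables (R : realType) (n m : nat) (f : {mpoly R[n]}) (g : 'I_m -> {mpoly R[n]}).
Variable ext : graph n -> graph n.
Hypothesis ext_valid : valid_chordal_ext ext.

Local Notation TS := (Gts R n m f g ext).
Local Notation F_ := (Fgraph R n m g).
Local Notation B_ := (Bset R n m g).
Local Notation gg := (gj R n m g).

Lemma gj0 : gg ord0 = 1.
Proof. by rewrite /gj unlift_none. Qed.

Lemma msumset_psupp_gj0 (S : set 'X_{1..n}) c : S c -> msumset n (psupp R n (gg ord0)) S c.
Proof.
by move=> Sc; exists 0%MM, c; rewrite /psupp /= gj0 msupp1 inE eqxx add0m.
Qed.

Lemma msumset_mono (S T T' : set 'X_{1..n}) :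
  (T `<=` T')%classic -> (msumset n S T `<=` msumset n S T')%classic.
Proof. by move=> TT' _ [a [b [Sa [/TT' Tb ->]]]]; exists a, b. Qed.

Lemma Fgraph_wf r j prev : wf_graph n (F_ r j prev).
Proof.
split; first exact: finite_Nk.
split=> [a b [ab [Ba [Bb _]]] //|a b [ab [Ba [Bb ab']]]].
by split; [exact/nesym | split=> //; split=> //; rewrite addmC].
Qed.

Lemma Fgraph_mono r r' j prev prev' : (r <= r')%N ->
  (forall i, subgraph n (prev i) (prev' i)) -> subgraph n (F_ r j prev) (F_ r' j prev').
Proof.
move=> rr' pp'.
have BB a : B_ r j a -> B_ r' j a by rewrite /Bset /Nk /= => ?; lia.
split=> [a|a b [ab [/BB Ba [/BB Bb [c [cab [i ci]]]]]]]; first exact: BB.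
split=> //; split=> //; split=> //; exists c; split=> //; exists i.
exact: msumset_mono (subgraph_gsupp (pp' i)) _ ci.
Qed.

Lemma subgraph_ext r j prev : subgraph n (F_ r j prev) (ext (F_ r j prev)).
Proof.
have [_ EV EE _] := ext_valid.1 _ (Fgraph_wf r j prev).
by split=> // a; rewrite EV.
Qed.

Lemma subgraph_ext_mono r r' j prev prev' : (r <= r')%N ->
  (forall i, subgraph n (prev i) (prev' i)) ->
  subgraph n (ext (F_ r j prev)) (ext (F_ r' j prev')).
Proof.
by move=> rr' pp'; apply: ext_valid.2; [exact: Fgraph_wf.. | exact: Fgraph_mono].
Qed.

(** The initial graphs are not chordal extensions, so the growth in [s] needs this separate start.
    For [j = 0] an edge puts [a + b] in both sumsets because [g_0 = 1]; the other initial graphs are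
    edgeless. *)
Lemma subgraph_G0_F r j : subgraph n (G0 R n m f g r j) (F_ r j (G0 R n m f g r)).
Proof.
rewrite {1}/G0; have [->|_] := eqVneq j ord0; last by split.
split=> // a b [ab [Ba [Bb Sab]]]; do 3!split=> //.
exists (a + b)%MM; split.
  exact: msumset_psupp_gj0.
exists ord0; apply: msumset_psupp_gj0.
by exists a, b; rewrite /G0 eqxx; split=> //; right.
Qed.

Lemma subgraph_TS_step r s j : subgraph n (TS r s j) (TS r s.+1 j).
Proof.
elim: s j => [|s IH] j /=; last exact: subgraph_ext_mono.
exact: subgraph_trans (subgraph_G0_F r j) (subgraph_ext _ _ _).
Qed.

Lemma subgraph_TS_0 r s j : subgraph n (TS r 0 j) (TS r s j).
Proof.
elim: s => [|s IH]; first by split.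
exact: subgraph_trans IH (subgraph_TS_step _ _ _).
Qed.

Lemma subgraph_TS_order r s j : subgraph n (TS r s j) (TS r.+1 s j).
Proof.
elim: s j => [|s IH] j /=; last exact: subgraph_ext_mono.
have BB a : B_ r j a -> B_ r.+1 j a by rewrite /Bset /Nk /= => ?; lia.
rewrite /G0; case: eqVneq => _; last by split.
split=> // a b [ab [/BB Ba [/BB Bb Sab]]]; do 3!split=> //.
by case: Sab => [|[d [/BB Bd dd]]]; [left | right; exists d].
Qed.

Lemma gV_TS r s j : gV (TS r s j) = B_ r j.
Proof.
case: s => [|s] /=; first by rewrite /G0; case: eqP.
by have [_ ->] := ext_valid.1 _ (Fgraph_wf r j (TS r s)).
Qed.

Lemma wf_TS r s j : (0 < s)%N -> wf_graph n (TS r s j).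
Proof.
case: s => // s _; by have [] := ext_valid.1 _ (Fgraph_wf r j (TS r s)).
Qed.

Lemma inpat_TS_sym r s j a b : (0 < s)%N -> inpat n (TS r s j) a b -> inpat n (TS r s j) b a.
Proof.
by move=> s0 [->|ab]; [left | right; apply: (wf_TS r j s0).2.2].
Qed.

(** As [r] is at least [rmin], [a] has degree at most [2r] and splits into two nodes. They are equal
    or adjacent in the initial graph, since [a] lies in the support of [f], and the later graphs
    contain that one. *)
Lemma gsupp_TS_msupp_f r s a : (rmin f g <= r)%N ->
  a \in msupp f -> gsupp n (TS r s ord0) a.
Proof.
move=> rr af; apply: (subgraph_gsupp (subgraph_TS_0 r s ord0)).
have ar : (mdeg a <= r + r)%N.
  have : (mdeg a <= pdeg R n f)%N by apply: leq_bigmax_seq.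
  by move: rr; rewrite /rmin /hdeg geq_max uphalf_half; lia.
have [b [c [br cr aE]]] := mnm_split ar.
have d0 : dj R n m g ord0 = 0%N.
  by rewrite /dj /hdeg gj0 /pdeg msupp1 big_seq1 mdeg0.
have Bb : B_ r ord0 b by rewrite /Bset d0 subn0.
have Bc : B_ r ord0 c by rewrite /Bset d0 subn0.
exists b, c; split=> //=; rewrite /G0 ?eqxx /=.
have [->|/eqP bc] := eqVneq b c; [by left | right].
by do 3!split=> //; left; left; rewrite -aE.
Qed.

End SparsityGraphs.

(** Without stabilisation the cardinality of [h s.+1] would be at least [s] for every [s]. *)
Lemma increasing_sets_stabilize (X : finType) (h : nat -> {set X}) :
  (forall s, h s \subset h s.+1) -> exists2 s, (1 <= s)%N & h s.+1 = h s.
Proof.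
move=> h_incr; apply/not_exists2P => nstab.
have lt_card s : (s <= #|h s.+1|)%N.
  elim: s => // s IH; apply: leq_ltn_trans IH _; apply: proper_card.
  rewrite finset.properEneq h_incr andbT; apply/eqP => E.
  by have [] := nstab s.+1; apply.
by have := lt_card #|X|.+1; rewrite ltnNge max_card.
Qed.

(** * The hierarchy *)

Section Hierarchy.
Variables (R : realType) (n m : nat) (f : {mpoly R[n]}) (g : 'I_m -> {mpoly R[n]}).

Local Notation gg := (gj R n m g).
Local Notation d_ := (dj R n m g).
Local Notation M_ := (Mmat R n m g).
Local Notation TS := (Gts R n m f g).
Local Notation L := (Ly R n).

(** The primal constraint as a matrix completion problem: only the pattern entries of the moment
    matrices are prescribed. *)
Definition completable r (G : 'I_m.+1 -> graph n) (y : 'X_{1..n} -> R) : Prop :=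
  forall j, exists2 Q, psd R (Idx n (r - d_ j)) Q &
    forall b c, inpat n (G j) (val b) (val c) -> Q b c = M_ r j y b c.

Lemma in_PiG_psdP (G : graph n) k (A : Idx n k -> Idx n k -> R) :
  in_PiG_psd R n G k (hadamard R _ (Bmask R n G k) A) <->
  exists2 Q, psd R _ Q & forall b c, inpat n G (val b) (val c) -> Q b c = A b c.
Proof.
split=> [[Q [Qpsd QE]]|[Q Qpsd QE]]; exists Q => //.
  move=> b c bc; have := congr1 (fun X => X b c) QE.
  by rewrite /PiG /hadamard /Bmask; case: pselect => //= _; rewrite mul1r.
split=> //; apply/funext => b; apply/funext => c; rewrite /PiG /hadamard /Bmask.
by case: pselect => [bc|nbc] /=; rewrite ?mul1r ?mul0r ?QE.
Qed.

Lemma f_tsE ext r s : f_ts f g ext r s =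
  ereal_inf [set (L y f)%:E | y in [set y | y 0%MM = 1 /\ completable r (TS ext r s) y]]%classic.
Proof.
rewrite /f_ts; congr (ereal_inf (image _ _)); apply/seteqP.
by split=> y /= [y0 yc]; split=> // j; apply/in_PiG_psdP; apply: yc.
Qed.

Lemma completable_anti r G H y :
  (forall j, subgraph n (G j) (H j)) -> completable r H y -> completable r G y.
Proof.
move=> GH yH j; have [Q Qpsd QE] := yH j; exists Q => // b c bc.
exact/QE/(subgraph_inpat (GH j)).
Qed.

(** The index set of the lower order embeds in that of the higher one, so a principal submatrix of
    the completion serves. *)
Lemma completable_order r r' G y : (r <= r')%N -> completable r' G y -> completable r G y.
Proof.
move=> rr' yG j; have [Q Qpsd QE] := yG j.
have lek : (r - d_ j <= r' - d_ j)%N by lia.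
pose h (b : Idx n (r - d_ j)) : Idx n (r' - d_ j) :=
  BMultinom (leq_trans (bmdeg b) (lek : (_.+1 <= _.+1)%N) : (mdeg b < (r' - d_ j).+1)%N).
by exists (fun b c => Q (h b) (h c)); [exact: psd_comp | move=> b c bc; exact: QE].
Qed.

Lemma completable_comb r G y z a : 0 <= a -> completable r G y -> completable r G z ->
  completable r G (fun c => a * y c + z c).
Proof.
move=> a0 yG zG j; have [P [Psym Pge] PE] := yG j; have [Q [Qsym Qge] QE] := zG j.
exists (fun b c => a * P b c + Q b c) => [|b c bc]; last by rewrite PE // QE // /Mmat LyD_y.
split=> [b c|v]; first by rewrite Psym Qsym.
by rewrite -/(qform _ v) qformD qformZ addr_ge0 ?mulr_ge0 //; [apply: Pge | apply: Qge].
Qed.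

Lemma f_ts_le_sparsity_order ext r s : valid_chordal_ext ext ->
  (f_ts f g ext r s <= f_ts f g ext r s.+1)%E.
Proof.
move=> extV; rewrite !f_tsE; apply: ereal_inf_le_tmp; apply: image_subset => y /= [y0 yc].
by split=> //; apply: completable_anti yc => j; apply: subgraph_TS_step.
Qed.

Lemma f_ts_le_relaxation_order ext r s : valid_chordal_ext ext ->
  (f_ts f g ext r s <= f_ts f g ext r.+1 s)%E.
Proof.
move=> extV; rewrite !f_tsE; apply: ereal_inf_le_tmp; apply: image_subset => y /= [y0 yc].
split=> //; apply: (completable_order (leqnSn r)).
by apply: completable_anti yc => j; apply: subgraph_TS_order.
Qed.

Lemma f_ts_le_f_mom ext r s : (f_ts f g ext r s <= f_mom f g r)%E.
Proof.
rewrite f_tsE; apply: ereal_inf_le_tmp; apply: image_subset => y /= [y0 yp].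
by split=> // j; exists (M_ r j y).
Qed.

(** The edges of all blocks together form an increasing sequence of subsets of one finite type. *)
Lemma sparsity_stabilizes ext r : valid_chordal_ext ext ->
  exists2 s, (1 <= s)%N & forall j b c, gV (TS ext r s j) b -> gV (TS ext r s j) c ->
    gE (TS ext r s.+1 j) b c -> gE (TS ext r s j) b c.
Proof.
move=> extV.
pose h s := [set p : {j : 'I_m.+1 & (Idx n (r - d_ j) * Idx n (r - d_ j))%type} |
  `[< gE (TS ext r s (tag p)) (val (tagged p).1) (val (tagged p).2) >]].
have hE s p : (p \in h s) = `[< gE (TS ext r s (tag p)) (val (tagged p).1) (val (tagged p).2) >].
  by rewrite finset.in_set.
have [s|s s1 hs] := @increasing_sets_stabilize _ h.
  apply/fintype.subsetP => p; rewrite !hE => /asboolP pE; apply/asboolP.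
  by have [_ sub] := subgraph_TS_step f g extV r s (tag p); exact: sub.
exists s => // j b c; rewrite gV_TS // => Bb Bc bc.
pose b' : Idx n (r - d_ j) := BMultinom (Bb : (mdeg b < (r - d_ j).+1)%N).
pose c' : Idx n (r - d_ j) := BMultinom (Bc : (mdeg c < (r - d_ j).+1)%N).
have : Tagged (fun j => (Idx n (r - d_ j) * Idx n (r - d_ j))%type) (b', c') \in h s.+1.
  by rewrite hE; apply/asboolP.
by rewrite hs hE => /asboolP.
Qed.

(* Once the graphs are stable, zeroing the moments outside their support leaves
   only the moment matrix entries on the cliques, a block-diagonal matrix. *)
Lemma f_ts_max_chordal_reaches_f_mom r : (rmin f g <= r)%N ->
  exists s, (1 <= s)%N /\ f_ts f g (@max_chordal_ext n) r s = f_mom f g r.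
Proof.
move=> rr; have extV := max_chordal_ext_valid n.
have [s s1 stable] := sparsity_stabilizes r extV.
exists s; split=> //; apply/eqP; rewrite eq_le f_ts_le_f_mom /= f_tsE.
set G := TS _ r s in stable *.
pose S : set 'X_{1..n} :=
  (fun a => exists i, msumset n (psupp R n (gg i)) (gsupp n (G i)) a).
apply: le_ereal_inf_tmp => _ [y [y0 yc] <-]; apply: ereal_inf_lbound.
(* This keeps [y_0] and [L_y(f)], because [S] contains 0 and the support of [f]. *)
pose z a : R := if `[< S a >] then y a else 0.
exists z; last first.
  congr EFin; apply: Ly_eq => a af; rewrite /z asboolT //.
  by exists ord0; apply: msumset_psupp_gj0; exact: gsupp_TS_msupp_f.
have VE j (b : Idx n (r - d_ j)) : gV (G j) (val b).
  by rewrite /G gV_TS // /Bset /Nk /= -ltnS bmdeg.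
split=> [|j].
  rewrite /z asboolT //; exists ord0; apply: msumset_psupp_gj0.
  exists 0%MM, 0%MM; rewrite addm0; split=> //; left; split=> //.
  by rewrite /G gV_TS // /Bset /Nk /= mdeg0.
have [Q Qpsd QE] := yc j.
pose e (b c : Idx n (r - d_ j)) := `[< inpat n (G j) (val b) (val c) >].
(* As [s >= 1], the graph is a maximal chordal extension, so its pattern is the equivalence relation
   of being connected. *)
have patE b c : e b c = `[< gconnected n (Fgraph R n m g r j (TS (@max_chordal_ext n) r s.-1)) (val b) (val c) >].
  have /= := VE j b; have /= := VE j c; rewrite /e /G; case: (s) s1 => //= s' _ Vc Vb.
  apply/asboolP/asboolP => [[<-|[_ [_ [_ //]]]]|bc]; first exact: gconnected_refl.
  by have [->|/eqP bc'] := eqVneq (val b) (val c); [left | right].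
have symF : forall a b, gE (Fgraph R n m g r j (TS (@max_chordal_ext n) r s.-1)) a b ->
    gE (Fgraph R n m g r j (TS (@max_chordal_ext n) r s.-1)) b a.
  by have [_ []] := Fgraph_wf g r j (TS (@max_chordal_ext n) r s.-1).
pose cls b := [set c | e b c].
have clsE b c : (cls b == cls c) = e b c.
  apply/eqP/idP => [bc|].
    have : c \in cls c by rewrite finset.in_set patE; apply/asboolP/gconnected_refl.
    by rewrite -bc finset.in_set.
  rewrite patE => /asboolP bc; apply/setP => x; rewrite !finset.in_set !patE.
  apply/asboolP/asboolP => [bx|]; last exact: gconnected_trans bc.
  exact: gconnected_trans (gconnected_sym symF bc) bx.
suff -> : M_ r j z = (fun b c => if cls b == cls c then Q b c else 0) by exact: psd_mask.
apply/funext => b; apply/funext => c; rewrite clsE /e.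
case: asboolP => bc.
  rewrite QE // /Mmat !LyMX; apply: eq_big_seq => d dg; rewrite /z asboolT //.
  exists j, d, (val b + val c)%MM; split=> //; split; last by rewrite addmC.
  by exists (val b), (val c); split=> //; case: bc; [left | right].
(* A monomial of [S] in this entry would make the pair an edge at step [s.+1], hence by stability
   already at step [s]. *)
rewrite /Mmat LyMX big_seq big1 // => d dg; rewrite /z asboolF ?mulr0 // => -[i Si].
apply: bc; have [->|/eqP bc] := eqVneq (val b) (val c); [by left | right].
apply: (stable j _ _ (VE j b) (VE j c)).
have [_] := subgraph_ext g extV r j (TS (@max_chordal_ext n) r s); apply.
split=> //; split; first by have := VE j b; rewrite /G gV_TS.
split; first by have := VE j c; rewrite /G gV_TS.
exists (val b + val c + d)%MM; split; last by exists i.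
by exists d, (val b + val c)%MM; split=> //; split=> //; rewrite addmC.
Qed.

End Hierarchy.

(** * Duality *)

Section MomentBlocks.
Variables (R : realType) (n m : nat) (g : 'I_m -> {mpoly R[n]}) (r : nat).

Local Notation gg := (gj R n m g).
Local Notation d_ := (dj R n m g).
Local Notation L := (Ly R n).

(** The disjoint union of the index sets gathers all constraints in one matrix, so that the
    extension theorem applies once. *)
Definition block_index : finType := {j : 'I_m.+1 & Idx n (r - d_ j)}.

Definition block_mon (u : block_index) : 'X_{1..n} := val (tagged u).

Definition in_block j (b : Idx n (r - d_ j)) : block_index :=
  Tagged (fun j => Idx n (r - d_ j)) b.

Definition block_diag (N : 'I_m.+1 -> 'X_{1..n} -> 'X_{1..n} -> R) (u v : block_index) : R :=
  if tag u == tag v then N (tag u) (block_mon u) (block_mon v) else 0.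

Lemma sum_block_index (F : block_index -> R) : \sum_u F u = \sum_j \sum_(b : Idx n (r - d_ j)) F (in_block b).
Proof. by rewrite sig_big_dep; apply: eq_bigr => -[j b]. Qed.

Lemma sum_block (W : block_index -> block_index -> R) N :
  \sum_u \sum_v W u v * block_diag N u v =
  \sum_j \sum_(b : Idx n (r - d_ j)) \sum_(c : Idx n (r - d_ j)) W (in_block b) (in_block c) * N j (val b) (val c).
Proof.
rewrite sum_block_index; apply: eq_bigr => j _; apply: eq_bigr => b _.
rewrite sum_block_index (bigD1 j) //= [X in _ + X]big1 ?addr0; last first.
  by move=> i ij; rewrite big1 // => c _; rewrite /block_diag  /= eq_sym (negbTE ij) mulr0.
by apply: eq_bigr => c _; rewrite /block_diag  /= eqxx.
Qed.

Lemma qform_block N (v : block_index -> R) :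
  qform (block_diag N) v =
  \sum_j qform (fun b c : Idx n (r - d_ j) => N j (val b) (val c)) (fun b : Idx n (r - d_ j) => v (in_block b)).
Proof.
have -> : qform (block_diag N) v = \sum_u \sum_w v u * v w * block_diag N u w.
  by apply: eq_bigr => u _; apply: eq_bigr => w _; ring.
rewrite sum_block; apply: eq_bigr => j _; apply: eq_bigr => b _.
by apply: eq_bigr => c _; ring.
Qed.

Definition entry (y : 'X_{1..n} -> R) (j : 'I_m.+1) (a b : 'X_{1..n}) : R :=
  L y (gg j * 'X_[a + b]).

Lemma interior_points D : nonempty_interior g ->
  exists (K : nat) (pt : nat -> 'I_n -> R), (forall k j, 0 <= (gg j).@[pt k]) /\
    forall p : {mpoly R[n]}, (msize p <= D)%N -> (forall k, (k < K)%N -> p.@[pt k] = 0) -> p = 0.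
Proof.
move=> [x0 [e [e0 xX]]].
have [K [pt [pt_near pt_det]]] := local_determining_points D x0 e0.
exists K, pt; split=> // k j; have ptX := xX _ (pt_near k).
by rewrite /gj; case: unlift => [i|]; [exact: ptX | rewrite meval1 ler01].
Qed.

(* A block with g_j = 0 has zero moment matrix; the identity makes it definite. *)
Definition pdef_entry y (j : 'I_m.+1) (a b : 'X_{1..n}) : R :=
  if gg j == 0 then (a == b)%:R else entry y j a b.

(** With [y] averaging over determining points of X, the form of block [j] is the average of
    [g_j q^2], where [q] has coefficient vector [v]. If it vanishes, [g_j q] is zero at every point,
    hence zero, and [q = 0] when [g_j] is nonzero. *)
Lemma posdef_moments : nonempty_interior g ->
  exists2 y, y 0%MM = 1 /\ (forall G, completable g r G y) &
    psd R block_index (block_diag (pdef_entry y)) /\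
    forall v, qform (block_diag (pdef_entry y)) v = 0 -> forall u, v u = 0.
Proof.
(* Large enough for the constant 1 and for every product of some [g_j] with a polynomial in the
   basis of its block. *)
pose D := (\sum_j msize (gg j) + r.+3)%N.
move=> /(interior_points D)[K [pt [pt_ge0 pt_det]]].
(* With no points at all, the polynomial 1 would have to be zero. *)
have K0 : (0 < K)%N.
  rewrite lt0n; apply/eqP => K0; have /eqP := oner_neq0 {mpoly R[n]}; apply.
  by apply: pt_det; rewrite ?msize1 ?K0 // /D addnS.
have K0R : (0 : R) < K%:R by rewrite ltr0n.
pose w := point_moments K pt.
pose y (a : 'X_{1..n}) := K%:R^-1 * w a.
have Ly_y p : L y p = K%:R^-1 * \sum_(l < K) p.@[pt l].
  by rewrite -Ly_point_moments /Ly big_distrr; apply: eq_bigr => a _; rewrite mulrCA.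
have entryE j b c : entry y j b c = K%:R^-1 * L w (gg j * 'X_[b + c]).
  by rewrite /entry Ly_y -Ly_point_moments.
have qE j (v : Idx n (r - d_ j) -> R) :
    qform (fun b c => entry y j (val b) (val c)) v
    = K%:R^-1 * \sum_(l < K) (gg j).@[pt l] * (idx_poly v).@[pt l] ^+ 2.
  rewrite -qform_point_moments -qformZ; congr (qform _ v).
  by apply/funext => b; apply/funext => c; rewrite entryE.
have entry_ge0 j (v : Idx n (r - d_ j) -> R) :
    0 <= qform (fun b c => entry y j (val b) (val c)) v.
  rewrite qE; apply: mulr_ge0; first by rewrite invr_ge0 ltW.
  by apply: sumr_ge0 => l _; apply: mulr_ge0 => //; exact: sqr_ge0.
have id_qform k (v : Idx n k -> R) :
    qform (fun b c : Idx n k => (val b == val c)%:R) v = \sum_b v b ^+ 2.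
  apply: eq_bigr => b _; rewrite (bigD1 b) //= eqxx mulr1 expr2 big1 ?addr0 // => c cb.
  have -> : (val b == val c) = false by rewrite (inj_eq val_inj) eq_sym; apply: negbTE.
  by rewrite mulr0 mul0r.
have blk_ge0 j (v : Idx n (r - d_ j) -> R) :
    0 <= qform (fun b c => pdef_entry y j (val b) (val c)) v.
  rewrite /pdef_entry; case: eqP => _; last exact: entry_ge0.
  by rewrite id_qform sumr_ge0 // => b _; rewrite sqr_ge0.
exists y; [split|split; [split=> [u v|v]|]].
- rewrite /y /w /point_moments; under eq_bigr do under eq_bigr do rewrite mnm0E expr0.
  under eq_bigr do rewrite big1_eq.
  by rewrite sumr_const card_ord mulVf ?gt_eqF.
- move=> G j; exists (Mmat R n m g r j y) => //; split=> [b c|v]; last exact: entry_ge0.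
  by rewrite /Mmat addmC.
- rewrite /block_diag eq_sym; case: eqP => // <-; rewrite /pdef_entry /entry addmC.
  by rewrite [block_mon u == _]eq_sym.
- rewrite -/(qform _ v) qform_block; apply: sumr_ge0 => j _; exact: blk_ge0.
move=> v; rewrite qform_block => v0 [j b].
have /(_ j isT) := psumr_eq0P (fun j _ => blk_ge0 j _) v0.
rewrite /pdef_entry; case: eqP => [_|/eqP gj0].
  rewrite id_qform => /psumr_eq0P h; apply/eqP; rewrite -sqrf_eq0; apply/eqP.
  by apply: h => // c _; rewrite sqr_ge0.
rewrite qE => /eqP; rewrite mulf_eq0 invr_eq0 gt_eqF //= => /eqP S0.
have h l : (l < K)%N -> (gg j * idx_poly (fun b : Idx n (r - d_ j) => v (in_block b))).@[pt l] = 0.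
  move=> lK; have /(_ (Ordinal lK) isT) := psumr_eq0P (fun i _ => mulr_ge0 (pt_ge0 _ _) (sqr_ge0 _)) S0.
  move=> /eqP; rewrite mulf_eq0 sqrf_eq0 mevalM => /orP[/eqP ->|/eqP ->]; first by rewrite mul0r.
  by rewrite mulr0.
suff /eqP : gg j * idx_poly (fun b : Idx n (r - d_ j) => v (in_block b)) = 0.
  rewrite mulf_eq0 (negbTE gj0) /= => /eqP v0'.
  exact: (@idx_poly_eq0 _ _ _ (fun b : Idx n (r - d_ j) => v (in_block b)) v0' b).
apply: pt_det h.
apply: leq_trans (msizeM_le _ _) _; have := msize_idx_poly (fun b : Idx n (r - d_ j) => v (in_block b)).
have : (msize (gg j) <= \sum_j msize (gg j))%N by rewrite (bigD1 j) //= leq_addr.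
by rewrite /D /=; move: (\sum_j msize (gg j))%N => N; lia.
Qed.

End MomentBlocks.

(** * Weak and strong duality *)

Section Duality.
Variables (R : realType) (n m : nat) (f : {mpoly R[n]}) (g : 'I_m -> {mpoly R[n]}).
Variables (ext : graph n -> graph n) (r s : nat).
Hypotheses (ext_valid : valid_chordal_ext ext) (s_gt0 : (1 <= s)%N)
  (r_ge : (rmin f g <= r)%N).

Local Notation gg := (gj R n m g).
Local Notation d_ := (dj R n m g).
Local Notation M_ := (Mmat R n m g r).
Local Notation L := (Ly R n).
Local Notation G_ := (Gts R n m f g ext r s).
Local Notation feasible y := (y 0%MM = 1 /\ completable g r G_ y).

Lemma CmatE j a b c : Cmat R n m g r j a b c = (gg j * 'X_[val b + val c])@_a.
Proof.
rewrite -Ly_dirac LyMX /Cmat big_mkcond; apply: eq_bigr => d _ /=.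
by case: eqP => _; rewrite ?mulr1 ?mulr0.
Qed.

Definition dual_feasible (b : R) : Prop :=
  exists Gm : forall j : 'I_m.+1, Idx n (r - d_ j) -> Idx n (r - d_ j) -> R,
    (forall j, psd R _ (Gm j) /\ in_SG R n (G_ j) _ (Gm j)) /\
    (forall a, (exists j, msumset n (psupp R n (gg j)) (gsupp n (G_ j)) a) ->
       \sum_(j < m.+1) frob R _ (Cmat R n m g r j a) (Gm j)
       = f@_a - (if a == 0%MM then b else 0)).

(** The gap is the sum over the blocks of the pairings of [Gm j] with a completion [Q] of the moment
    matrix. Entries of [Q] off the pattern do not matter, since [Gm j] vanishes there. *)
Lemma weak_duality y b : feasible y -> dual_feasible b -> b <= L y f.
Proof.
move=> [y0 yc] [Gm [GmP GmE]].
(* At monomials outside the listed supports the equation reads 0 = 0, so it can be multiplied by any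
   moment and summed. *)
have eqn_all a : \sum_(j < m.+1) frob R _ (Cmat R n m g r j a) (Gm j)
       = f@_a - (if a == 0%MM then b else 0).
  have [aS|aS] := pselect (exists j, msumset n (psupp R n (gg j)) (gsupp n (G_ j)) a).
    exact: GmE.
  have inS c : gsupp n (G_ ord0) c -> a <> c.
    by move=> cS ac; apply: aS; exists ord0; rewrite ac; apply: msumset_psupp_gj0.
  rewrite (_ : (a == 0%MM) = false) ?subr0; last first.
    apply/eqP/inS; exists 0%MM, 0%MM; rewrite addm0; split=> //; left; split=> //.
    by rewrite gV_TS // /Bset /Nk /= mdeg0.
  rewrite memN_msupp_eq0; last first.
    by apply/negP => /(gsupp_TS_msupp_f ext_valid s r_ge) /inS.
  rewrite big1 // => j _; rewrite /frob big1 // => u _; rewrite big1 // => v _.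
  have [uv|uv] := pselect (inpat n (G_ j) (val u) (val v)); last first.
    rewrite (GmP j).2.2 ?mulr0 // => [vu|vu]; apply: uv; first by left; rewrite vu.
    by apply: inpat_TS_sym => //; right.
  rewrite /Cmat big_seq_cond big1 ?mul0r // => d /andP[dg /eqP uvd].
  case: aS; exists j, d, (val u + val v)%MM; split=> //; split; last by rewrite addmC.
  by exists (val u), (val v); split=> //; case: uv; [left; split=> //|right];
    rewrite ?gV_TS // /Bset /Nk /= -ltnS bmdeg.
pose D := (msize f + \sum_j msize (gg j) + (r + r).+2)%N.
have fD : (msize f <= D.+1)%N by rewrite /D; lia.
have MD j (u v : Idx n (r - d_ j)) : (msize (gg j * 'X_[val u + val v]) <= D.+1)%N.
  apply: leq_trans (msizeM_le _ _) _; rewrite msizeX mdegD.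
  have := bmdeg u; have := bmdeg v.
  have : (msize (gg j) <= \sum_j msize (gg j))%N by rewrite (bigD1 j) //= leq_addr.
  by rewrite /D /=; move: (\sum_j msize (gg j))%N => N; lia.
rewrite -subr_ge0.
have -> : L y f - b = \sum_(a : Idx n D) (f@_(val a) - (if val a == 0%MM then b else 0)) * y (val a).
  under eq_bigr do rewrite mulrBl.
  rewrite sumrB -Ly_coef_sum //; congr (_ - _).
  have D0 : (mdeg (0%MM : 'X_{1..n}) < D.+1)%N by rewrite mdeg0.
  rewrite (bigD1 (BMultinom D0)) //= eqxx y0 mulr1 big1 ?addr0 // => a a0.
  have -> : (val a == 0%MM) = (a == BMultinom D0) by rewrite bmeqP.
  by rewrite (negbTE a0) mul0r.
under eq_bigr do rewrite -eqn_all big_distrl /=.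
rewrite exchange_big /=; apply: sumr_ge0 => j _.
have [Q Qpsd QE] := yc j; have [Gpsd [Gsym G0]] := GmP j.
suff -> : \sum_(a : Idx n D) frob R _ (Cmat R n m g r j (val a)) (Gm j) * y (val a)
    = \sum_u \sum_v Q u v * Gm j u v by apply: psd_frob_ge0.
rewrite /frob; under eq_bigr do rewrite big_distrl /=.
rewrite exchange_big /=; apply: eq_bigr => u _.
under eq_bigr do rewrite big_distrl /=.
rewrite exchange_big /=; apply: eq_bigr => v _.
rewrite [Gm j v u]Gsym.
have [uv|uv] := pselect (inpat n (G_ j) (val u) (val v)).
  rewrite QE // /Mmat (Ly_coef_sum _ (MD j u v)) big_distrl /=.
  by apply: eq_bigr => a _; rewrite CmatE mulrAC.
rewrite G0 ?mulr0 => [|uv'|uv']; last 2 first.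
- by apply: uv; left; rewrite uv'.
- by apply: uv; right.
by rewrite big1 // => a _; rewrite mulr0 mul0r.
Qed.

Local Notation T := (block_index g r).
Local Notation block := (@block_diag R n m g r).

(** Blocks with [g_j = 0] are left out, because there [pdef_entry] is an identity and not a moment
    matrix. *)
Let pat (u v : T) : Prop :=
  [/\ tag u = tag v, gg (tag u) != 0 & inpat n (G_ (tag u)) (block_mon u) (block_mon v)].

Lemma entry0 y a b : entry g y ord0 a b = y (a + b)%MM.
Proof. by rewrite /entry gj0 mul1r Ly_monomial. Qed.

Lemma gj_0_neq0 : gg ord0 != 0.
Proof. by rewrite gj0 oner_eq0. Qed.

(** Fixes for each monomial of [f] a pattern position of block 0 that holds its moment, so that
    [L_y(f)] can be computed from the matrix alone. *)
Lemma pat_msupp_f : exists e : 'X_{1..n} -> T * T, forall a, a \in msupp f ->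
  [/\ pat (e a).1 (e a).2, tag (e a).1 = ord0 & (block_mon (e a).1 + block_mon (e a).2)%MM = a].
Proof.
suff: forall a, exists uv : T * T, a \in msupp f ->
  [/\ pat uv.1 uv.2, tag uv.1 = ord0 & (block_mon uv.1 + block_mon uv.2)%MM = a].
  by move=> /boolp.choice[e eP]; exists e.
move=> a; have [af|_] := boolP (a \in msupp f); last first.
  have z0 : (mdeg (0%MM : 'X_{1..n}) < (r - d_ ord0).+1)%N by rewrite mdeg0.
  pose z : Idx n (r - d_ ord0) := BMultinom z0.
  by exists (in_block z, in_block z).
have [b [c [bc ->]]] := gsupp_TS_msupp_f ext_valid s r_ge af.
have [Vb Vc] : gV (G_ ord0) b /\ gV (G_ ord0) c.
  case: bc => [[<-] //|bc].
  by have [_ [/(_ _ _ bc)[_ []]]] := wf_TS f g ext_valid r ord0 s_gt0.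
rewrite gV_TS // in Vb Vc.
pose b' : Idx n (r - d_ ord0) := BMultinom (Vb : (mdeg b < (r - d_ ord0).+1)%N).
pose c' : Idx n (r - d_ ord0) := BMultinom (Vc : (mdeg c < (r - d_ ord0).+1)%N).
exists (in_block b', in_block c') => _; split=> //; split=> //; first exact: gj_0_neq0.
by case: bc => [[bc _]|bc]; [left | right].
Qed.

Lemma strong_duality p : nonempty_interior g ->
  (forall y, feasible y -> p <= L y f) -> dual_feasible p.
Proof.
move=> /(posdef_moments r)[y1 [y10 y1c] [Mpsd Mdef]] pL.
have [e eP] := pat_msupp_f.
have z0 : (mdeg (0%MM : 'X_{1..n}) < (r - d_ ord0).+1)%N by rewrite mdeg0.
pose u0 : T := in_block (BMultinom z0 : Idx n (r - d_ ord0)).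
have u0P : pat u0 u0 by split=> //; [exact: gj_0_neq0 | left].
pose agree (A : T -> T -> R) y :=
  forall u v, pat u v -> A u v = entry g y (tag u) (block_mon u) (block_mon v).
pose F A := exists y, agree A y.
pose phi (A : T -> T -> R) :=
  \sum_(a <- msupp f) f@_a * A (e a).1 (e a).2 - p * A u0 u0.
have agree0 A y : agree A y -> A u0 u0 = y 0%MM.
  by move=> /(_ _ _ u0P) ->; rewrite entry0 addm0.
have phiE A y : agree A y -> phi A = L y f - p * y 0%MM.
  move=> Ay; rewrite /phi (agree0 A y Ay); congr (_ - _).
  by apply: eq_big_seq => a /eP[pa ta aE]; rewrite (Ay _ _ pa) ta entry0 aE.
have block_agree y : agree (block (entry g y)) y.
  by move=> u v [uv _ _]; rewrite /block_diag uv eqxx.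
have agreeD a A B y z : agree A y -> agree B z ->
    agree (fun u v => a * A u v + B u v) (fun c => a * y c + z c).
  by move=> Ay Bz u v uv; rewrite Ay // Bz // /entry LyD_y.
have Ly_zero q : L (fun _ => 0) q = 0.
  by rewrite /Ly big1 // => a _; rewrite mulr0.
have agree_zero : agree (fun _ _ => 0) (fun _ => 0).
  by move=> u v _; rewrite /entry Ly_zero.
have cone_pos y : completable g r G_ y -> 0 <= y 0%MM -> 0 <= L y f - p * y 0%MM.
  move=> yc; rewrite le_eqVlt => /predU1P[y0|y0].
    rewrite -y0 mulr0 subr0 leNgt; apply/negP => Lneg.
    have pL1 : p <= L y1 f by apply: pL.
    (* Here [y] is a recession direction; moving from [y1] by [t] along it would give the value
       [p - 1]. *)
    pose t := (L y1 f - p + 1) / - L y f.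
    have t0 : 0 <= t by rewrite divr_ge0 //; lra.
    have /pL : feasible (fun c => t * y c + y1 c).
      by rewrite -y0 mulr0 add0r; split=> //; apply: completable_comb.
    rewrite LyD_y /t -mulrA invrN mulNr mulVf ?lt_eqF // mulrN1; lra.
  have /pL : feasible (fun c => (y 0%MM)^-1 * y c + 0).
    split; first by rewrite addr0 mulVf ?gt_eqF.
    apply: completable_comb => //; first by rewrite invr_ge0 ltW.
    move=> j; exists (fun _ _ => 0) => [|b c _]; first split=> // v.
      by rewrite big1 // => b _; rewrite big1 // => c _; rewrite mulr0 mul0r.
    by rewrite /Mmat Ly_zero.
  by rewrite LyD_y Ly_zero addr0 mulrC ler_pdivlMr // subr_ge0.
have phi_pos A : F A -> (forall v, 0 <= qform A v) -> 0 <= phi A.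
  move=> [y Ay] Age0; rewrite (phiE A y Ay); apply: cone_pos; last first.
    by rewrite -(agree0 A y Ay) -qform_delta.
  (* Symmetrising makes [A] positive semidefinite and keeps the pattern entries, as moment matrices
     and patterns are symmetric. *)
  pose B u v := 2^-1 * (A u v + A v u).
  have Bpsd : psd R T B.
    split=> [u v|v]; first by rewrite /B addrC.
    rewrite -/(qform B v) /B qformZ qformD (qform_tr A).
    by rewrite mulr_ge0 ?invr_ge0 ?addr_ge0.
  have By : agree B y.
    move=> u v uv; have [tuv gu uvG] := uv.
    have vu : pat v u by split; rewrite -?tuv //; exact: inpat_TS_sym.
    by rewrite /B (Ay _ _ uv) (Ay _ _ vu) -tuv /entry [(block_mon v + _)%MM]addmC; field.
  move=> j; have [gj0|gjn0] := eqVneq (gg j) 0.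
    exists (fun _ _ => 0) => [|b c _]; last by rewrite /Mmat gj0 mul0r /Ly msupp0 big_nil.
    split=> // v.
    by rewrite big1 // => b _; rewrite big1 // => c _; rewrite mulr0 mul0r.
  exists (fun b c => B (in_block b) (in_block c)); first exact: psd_comp.
  by move=> b c bc; rewrite By.
have FM : F (block (pdef_entry g y1)).
  by exists y1 => u v [uv gu _]; rewrite /block_diag uv eqxx /pdef_entry -uv (negbTE gu).
have [//|||H Hpsd HE] := psd_functional_extension _ _ _ phi_pos FM Mpsd Mdef.
- by exists (fun _ => 0).
- by move=> a A B [y Ay] [z Bz]; exists (fun c => a * y c + z c); apply: agreeD.
- move=> a A B _ _; rewrite /phi.
  set x := \sum_(c <- msupp f) _.
  have -> : x = a * (\sum_(c <- msupp f) f@_c * A (e c).1 (e c).2)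
              + \sum_(c <- msupp f) f@_c * B (e c).1 (e c).2.
    by rewrite /x big_distrr -big_split; apply: eq_bigr => c _ /=; ring.
  by ring.
exists (fun j b c => H (in_block b) (in_block c)); split=> [j|a _].
  split; first exact: psd_comp.
  split=> [b c|b c bc nbc]; first exact: Hpsd.1.
  (* An elementary matrix off the pattern agrees with zero moments, so [phi] vanishes on it, and so
     does this entry of [H]. *)
  pose A (u v : T) : R := ((u == in_block b) && (v == in_block c))%:R.
  have A0 : agree A (fun _ => 0).
    move=> u v [tuv gu uvG]; rewrite -(agree_zero u v) // /A.
    case: eqP => //= ub; case: eqP => //= vc; subst u v.
    by case: uvG => [/val_inj|].
  have := HE A (ex_intro _ _ A0); rewrite (phiE _ _ A0) mulr0 subr0 Ly_zero.
  rewrite (bigD1 (in_block b)) //= [X in _ = _ + X -> _]big1 ?addr0; last first.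
    by move=> u /negbTE ub; rewrite big1 // => v _; rewrite /A ub mulr0.
  rewrite (bigD1 (in_block c)) //= big1 ?addr0; last first.
    by move=> v /negbTE vc; rewrite /A vc andbF mulr0.
  by rewrite /A !eqxx mulr1.
(* Testing on the Dirac family at [a] gives the coefficient equation at [a]. *)
pose y (c : 'X_{1..n}) : R := (c == a)%:R.
have Fy : F (block (entry g y)) by exists y.
have := HE _ Fy; rewrite (phiE _ _ (block_agree y)) Ly_dirac sum_block => E.
transitivity (f@_a - p * y 0%MM); last first.
  by rewrite /y eq_sym; case: eqP => _; rewrite ?mulr1 ?mulr0.
rewrite E; apply: eq_bigr => j _; apply: eq_bigr => b _; apply: eq_bigr => c _.
by rewrite CmatE Hpsd.1 mulrC /entry Ly_dirac.
Qed.

End Duality.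

Unset Implicit Arguments.
Set Strict Implicit.

Theorem theorem7p4 (R : realType) (n m : nat) (f : mpoly.mpoly n R)
    (g : 'I_m -> mpoly.mpoly n R) (ext : graph n -> graph n) :
  valid_chordal_ext ext ->
  (* (i) *)
  (nonempty_interior g ->
     forall r s, (rmin f g <= r)%N -> (1 <= s)%N ->
       f_ts f g ext r s = f_ts_dual f g ext r s) /\
  (* (ii) *)
  (forall r, (rmin f g <= r)%N ->
     (forall s, (1 <= s)%N -> (f_ts f g ext r s <= f_ts f g ext r s.+1)%E) /\
     (forall s, (1 <= s)%N -> (f_ts f g ext r s <= f_mom f g r)%E)) /\
  (* (iii) *)
  (forall r, (rmin f g <= r)%N ->
     exists s0, (1 <= s0)%N /\ f_ts f g (@max_chordal_ext n) r s0 = f_mom f g r) /\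
  (* (iv) *)
  (forall s, (1 <= s)%N ->
     forall r, (rmin f g <= r)%N -> (f_ts f g ext r s <= f_ts f g ext r.+1 s)%E).
Proof.
move=> extV; split; last split; last split.
- move=> inter r s rr s1; apply/eqP; rewrite eq_le; apply/andP; split; last first.
    rewrite f_tsE; apply: le_ereal_inf_tmp => _ [y yf <-].
    apply: ge_ereal_sup => _ [b bf <-].
    by rewrite lee_fin; exact: (weak_duality extV s1 rr yf bf).
  have [y [y0 yc] _] := posdef_moments r inter.
  have le_feas z : z 0%MM = 1 /\ completable g r (Gts R n m f g ext r s) z ->
      (f_ts f g ext r s <= (Ly R n z f)%:E)%E.
    by move=> zf; rewrite f_tsE; apply: ereal_inf_lbound; exists z.
  (* A feasible point excludes the value plus infinity, and minus infinity is trivial; a finite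
     value is a lower bound to which strong duality applies. *)
  case fE: (f_ts f g ext r s) (le_feas y (conj y0 (yc _))) => [p| |] // _; last exact: leNye.
  apply: ereal_sup_ubound; exists p => //.
  apply: (strong_duality extV s1 rr inter) => z /le_feas.
  by rewrite fE lee_fin.
- move=> r rr; split=> s s1; [exact: f_ts_le_sparsity_order | exact: f_ts_le_f_mom].
- by move=> r rr; apply: f_ts_max_chordal_reaches_f_mom.
- by move=> s s1 r rr; apply: f_ts_le_relaxation_order.
Qed.
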